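(* Let $K_{1,2}$ be the 2-star (path with two edges). Suppose $W$ is a $K_{1,2}$-regular graphon with $t(K_{1,2},W)>0$, and suppose that it is not the case that $W=1$ a.e. on $[0,1]^2$. Then the limit in distribution, as $n\to\infty$, of $$Z_n(K_{1,2},W):=\frac{X_n(K_{1,2},W)-\frac{(n)_3}{|\mathrm{Aut}(K_{1,2})|}t(K_{1,2},W)}{n^2},$$ namely the law of $\sigma_{K_{1,2},W}\cdot Z+\sum_{\lambda\in\mathrm{Spec}^-(W_{K_{1,2}})}\lambda(Z_\lambda^2-1)$ with $Z$ and $\{Z_\lambda\}$ independent standard Gaussians, is non-degenerate (i.e. not almost surely constant).
   Context: A graphon is a measurable symmetric function $W:[0,1]^2\to[0,1]$. Let $\{U_i\}_{i\ge1}$ and $\{Y_{ij}\}_{i<j}$ be mutually independent families of i.i.d. uniform $[0,1]$ random variables. The $W$-random graph $G(n,W)$ on $\{1,\ldots,n\}$ contains the edge $\{i,j\}$ iff $Y_{ij}\le W(U_i,U_j)$. For a simple graph $H$ on $V(H)=\{1,\ldots,|V(H)|\}$, $X_n(H,W)$ is the number of (unlabelled) copies of $H$ in $G(n,W)$. $\mathrm{Aut}(H)$ is the automorphism group of $H$; $(n)_k=n(n-1)\cdots(n-k+1)$. For a finite loopless multigraph $F$, $t(F,W)=\int_{[0,1]^{|V(F)|}}\prod_{(a,b)\in E(F)}W(x_a,x_b)\prod_adx_a$, edges taken with multiplicity. For distinct vertices $a_1,\ldots,a_K$ of $H$, $t_{a_1,\ldots,a_K}((x_1,\ldots,x_K),H,W)$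 is obtained by fixing the variable of vertex $a_j$ to be $x_j$ and integrating $\prod_{(a,b)\in E(H)}W$ over the remaining vertex variables in $[0,1]$. $W$ is $H$-regular if $\frac1{|V(H)|}\sum_at_a(x,H,W)=t(H,W)$ for a.e. $x\in[0,1]$. $E^+(H)$ is the set of ordered pairs of adjacent vertices of $H$. For $(a,b),(c,d)\in E^+(H)$, take two disjoint copies of $H$, identify vertex $a$ of the first with vertex $c$ of the second and vertex $b$ of the first with vertex $d$ of the second; $H\ominus_{(a,b),(c,d)}H$ keeps a single edge between the two identified vertices and $H\oplus_{(a,b),(c,d)}H$ keeps both (a double edge). Then $\sigma_{H,W}\ge0$ is defined by $\sigma^2_{H,W}=\frac1{2|\mathrm{Aut}(H)|^2}\sum_{(a,b),(c,d)\in E^+(H)}\big[t(H\ominus_{(a,b),(c,d)}H,W)-t(H\oplus_{(a,b),(c,d)}H,W)\big]$. $W_H(x,y)=\frac1{2|\mathrm{Aut}(H)|}\sum_{1\le a\ne b\le|V(H)|}t_{a,b}((x,y),H,W)$ (ordered pairs). $\mathrm{Spec}(W_H)$ is the multiset of non-zero eigenvalues of the integral operator on $L^2[0,1]$ with kernel $W_H$. When $W$ is $H$-regular, $\int_0^1W_H(x,y)\,dy=d_{W_H}:=\frac{|V(H)|(|V(H)|-1)}{2|\mathrm{Aut}(H)|}t(H,W)$ for a.e. $x$, so $d_{W_H}$ is an eigenvalue with eigenfunction $1$; $\mathrm{Spec}^-(W_H)$ is $\mathrm{Spec}(W_H)$ with the multiplicity of $d_{W_H}$ decreased by $1$. For $H$-regular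 $W$, $Z_n(H,W):=\big(X_n(H,W)-\frac{(n)_{|V(H)|}}{|\mathrm{Aut}(H)|}t(H,W)\big)/n^{|V(H)|-1}$ converges in distribution to $\sigma_{H,W}Z+\sum_{\lambda\in\mathrm{Spec}^-(W_H)}\lambda(Z_\lambda^2-1)$. *)

(* Defs.v *)
From HB Require Import structures.
From mathcomp Require Import all_boot all_order all_fingroup all_algebra.
From mathcomp Require Import all_classical all_reals all_analysis.

Set Implicit Arguments.
Unset Strict Implicit.
Unset Printing Implicit Defensive.

Import Order.TTheory GRing.Theory Num.Theory.
Import numFieldNormedType.Exports.

Local Open Scope classical_set_scope.
Local Open Scope ring_scope.

Record sgraph (k : nat) := SGraph {
  adj :> rel 'I_k;
  adj_sym : symmetric adj;
  adj_irr : irreflexive adj }.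

(* Vertices live in an ambient type [V]; edges are listed with multiplicity,
   each in an arbitrary orientation. *)
Record multigraph (V : eqType) := Multigraph {
  mvertices : seq V;
  medges : seq (V * V) }.

Section SimpleGraph.
Variables (k : nat) (H : sgraph k).

(* Each unordered edge is listed once, smaller endpoint first. *)
Definition edges : seq ('I_k * 'I_k) :=
  [seq e : 'I_k * 'I_k <- enum predT | (e.1 < e.2)%N && H e.1 e.2].

Definition multigraph_of : multigraph 'I_k :=
  Multigraph (enum 'I_k) edges.

Definition automorphisms : {set {perm 'I_k}} :=
  [set s : {perm 'I_k} | [forall a, forall b, H (s a) (s b) == H a b]]%SET.

(* Two disjoint copies of H are the two summands of ['I_k + 'I_k]; vertices c
   and d of the second copy are merged into a and b of the first one. *)
Definition merge (a b c d v : 'I_k) : 'I_k + 'I_k :=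
  if v == c then inl a else if v == d then inl b else inr v.

Definition glue_vertices (c d : 'I_k) : seq ('I_k + 'I_k) :=
  [seq inl v | v <- enum 'I_k] ++
  [seq inr v | v <- enum 'I_k & v \notin [:: c; d]].

Definition oplus (a b c d : 'I_k) : multigraph ('I_k + 'I_k)%type :=
  Multigraph (glue_vertices c d)
    ([seq (inl e.1, inl e.2) | e <- edges] ++
     [seq (merge a b c d e.1, merge a b c d e.2) | e <- edges]).

Definition ominus (a b c d : 'I_k) : multigraph ('I_k + 'I_k)%type :=
  Multigraph (glue_vertices c d)
    ([seq (inl e.1, inl e.2) | e <- edges] ++
     [seq (merge a b c d e.1, merge a b c d e.2)
        | e <- edges & (e != (c, d)) && (e != (d, c))]).

End SimpleGraph.

Definition star2_adj : rel 'I_3 :=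
  fun a b => (a != b) && ((a == ord0) || (b == ord0)).

Lemma star2_sym : symmetric star2_adj.
Proof. by move=> a b; rewrite /star2_adj eq_sym orbC. Qed.

Lemma star2_irr : irreflexive star2_adj.
Proof. by move=> a; rewrite /star2_adj eqxx. Qed.

Definition K12 : sgraph 3 := SGraph star2_sym star2_irr.

Section Copies.
Variables (k : nat) (H : sgraph k) (n : nat).

(* The subgraph (vertex set, edge set) that is the image of H under f. *)
Definition image_graph (f : {ffun 'I_k -> 'I_n}) :
    {set 'I_n} * {set {set 'I_n}} :=
  ([set f a | a : 'I_k]%SET,
   [set [set f e.1; f e.2] | e in [set e : 'I_k * 'I_k | H e.1 e.2]]%SET).

(* Distinct embeddings with the same image are the same unlabelled copy. *)
Definition copies (g : rel 'I_n) : {set {set 'I_n} * {set {set 'I_n}}} :=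
  [set image_graph f | f in [set f : {ffun 'I_k -> 'I_n} |
     injectiveb f && [forall a, forall b, H a b ==> g (f a) (f b)]]]%SET.

End Copies.

Section Graphon.
Variable R : realType.
Local Notation mu := (@lebesgue_measure R).
Local Notation I01 := (`[0%R, 1%R]%classic : set R).

(* Only the values of W on the unit square matter. *)
Definition graphon (W : R -> R -> R) : Prop :=
  [/\ measurable_fun (I01 `*` I01) (fun p : R * R => W p.1 p.2),
      {in I01 &, forall x y, W x y = W y x} &
      {in I01 &, forall x y, 0 <= W x y <= 1}].

(* Iterated integral over [0,1] of the variables listed in s, the other
   variables keeping the value prescribed by the assignment x. *)
Fixpoint integrate_out (V : eqType) (s : seq V) (f : (V -> R) -> R)
    (x : V -> R) : R :=
  if s is v :: s' then
    \int[mu]_(y in I01) integrate_out s' f [eta x with v |-> y]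
  else f x.

Definition edge_prod (V : eqType) (W : R -> R -> R) (F : multigraph V)
    (x : V -> R) : R :=
  \prod_(e <- medges F) W (x e.1) (x e.2).

Definition density (V : eqType) (F : multigraph V) (W : R -> R -> R) : R :=
  integrate_out (mvertices F) (edge_prod W F) (fun=> 0).

(* The vertices [marks] carry the respective values [xs]. *)
Definition marked_density (V : eqType) (marks : seq V) (xs : seq R)
    (F : multigraph V) (W : R -> R -> R) : R :=
  integrate_out [seq v <- mvertices F | v \notin marks] (edge_prod W F)
    (fun v => nth 0 xs (index v marks)).

Section Kernel.
Variables (k : nat) (H : sgraph k) (W : R -> R -> R).

Definition t : R := density (multigraph_of H) W.

Definition regular : Prop :=
  {ae mu, forall x, I01 x ->
     k%:R^-1 * \sum_(a < k) marked_density [:: a] [:: x] (multigraph_of H) W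
     = t}.

Definition sigma2 : R :=
  (2 * #|automorphisms H|%:R ^+ 2)^-1 *
  \sum_(p : 'I_k * 'I_k | H p.1 p.2) \sum_(q : 'I_k * 'I_k | H q.1 q.2)
    (density (ominus H p.1 p.2 q.1 q.2) W -
     density (oplus H p.1 p.2 q.1 q.2) W).

Definition sigma : R := Num.sqrt sigma2.

Definition W_H (x y : R) : R :=
  (2 * #|automorphisms H|%:R)^-1 *
  \sum_(a < k) \sum_(b < k | b != a)
    marked_density [:: a; b] [:: x; y] (multigraph_of H) W.

Definition d_WH : R := (k * k.-1)%N%:R / (2 * #|automorphisms H|%:R) * t.

End Kernel.

Definition in_L2 (f : R -> R) : Prop :=
  measurable_fun I01 f /\ mu.-integrable I01 (fun x => (f x ^+ 2)%:E).

(* f lies in the r-eigenspace (f may vanish a.e.). *)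
Definition eigenfunction (K : R -> R -> R) (r : R) (f : R -> R) : Prop :=
  in_L2 f /\
  {ae mu, forall x, I01 x -> \int[mu]_(y in I01) (K x y * f y) = r * f x}.

(* The r-eigenspace, as a subspace of L^2[0,1] (functions up to a.e.
   equality), has a basis of m elements. *)
Definition multiplicity (K : R -> R -> R) (r : R) (m : nat) : Prop :=
  exists f : 'I_m -> R -> R,
    [/\ forall i, eigenfunction K r (f i),
        forall c : 'I_m -> R,
          {ae mu, forall x, I01 x -> \sum_i c i * f i x = 0} ->
          forall i, c i = 0 &
        forall g, eigenfunction K r g ->
          exists c : 'I_m -> R,
            {ae mu, forall x, I01 x -> g x = \sum_i c i * f i x}].

(* The non-zero terms of the sequence [lam], with repetitions, form the
   multiset Spec^-(W_H); zero terms are padding, as this multiset may be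
   finite. *)
Definition enumerates_spec_minus (k : nat) (H : sgraph k) (W : R -> R -> R)
    (lam : nat -> R) : Prop :=
  forall r : R, r != 0 -> exists2 m, multiplicity (W_H H W) r m &
    ([set i | lam i = r] #= `I_(m - (r == d_WH H W))%N)%card.

End Graphon.

Section Probability.
Context d (T : measurableType d) (R : realType) (P : probability T R).

(* Mutual independence of the family X restricted to the indices in D. *)
Definition mutually_independent (I : eqType) (D : set I) (X : I -> T -> R) :
    Prop :=
  forall (s : seq I) (A : I -> set R),
    uniq s -> (forall i, i \in s -> D i) -> (forall i, measurable (A i)) ->
    P (\bigcap_(i in [set` s]) (X i @^-1` A i)) =
    (\prod_(i <- s) P (X i @^-1` A i))%E.

Definition uniform01 (X : {RV P >-> R}) : Prop :=
  (forall w, 0 <= X w <= 1) /\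
  forall A : set R, measurable A ->
    distribution P X A = uniform_prob (@ltr01 R) A.

Definition standard_gaussian (X : {RV P >-> R}) : Prop :=
  forall A : set R, measurable A -> distribution P X A = normal_prob 0 1 A.

(* [Y i j] is only relevant for i < j. *)
Definition uniform_sample (U : nat -> {RV P >-> R})
    (Y : nat -> nat -> {RV P >-> R}) : Prop :=
  [/\ forall i, uniform01 (U i),
      forall i j, (i < j)%N -> uniform01 (Y i j) &
      mutually_independent
        [set z : nat + nat * nat | if z is inr (i, j) then (i < j)%N else true]
        (fun z => match z with inl i => U i | inr (i, j) => Y i j end)].

Definition gaussian_sample (Z : {RV P >-> R}) (G : nat -> {RV P >-> R}) :
    Prop :=
  [/\ standard_gaussian Z, forall i, standard_gaussian (G i) &
      mutually_independent setT
        (fun z : option nat => if z is Some i then G i : T -> R else Z)].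

(* Vertices are numbered from 0. *)
Definition random_graph (W : R -> R -> R) (U : nat -> {RV P >-> R})
    (Y : nat -> nat -> {RV P >-> R}) (n : nat) (w : T) : rel 'I_n :=
  fun i j =>
    (i < j)%N && (Y i j w <= W (U i w) (U j w)) ||
    (j < i)%N && (Y j i w <= W (U j w) (U i w)).

Definition X_n (k : nat) (H : sgraph k) (W : R -> R -> R)
    (U : nat -> {RV P >-> R}) (Y : nat -> nat -> {RV P >-> R})
    (n : nat) (w : T) : nat :=
  #|copies H (@random_graph W U Y n w)|.

Definition Z_n (k : nat) (H : sgraph k) (W : R -> R -> R)
    (U : nat -> {RV P >-> R}) (Y : nat -> nat -> {RV P >-> R})
    (n : nat) (w : T) : R :=
  ((X_n H W U Y n w)%:R - (n ^_ k)%:R / #|automorphisms H|%:R * t H W) / n%:R ^+ k.-1.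

(* L = sigma Z + sum_{lambda in Spec^-} lambda (Z_lambda^2 - 1), the series
   converging almost surely; G i plays the role of Z_lambda for
   lambda = lam i. *)
Definition limit_variable (k : nat) (H : sgraph k) (W : R -> R -> R)
    (lam : nat -> R) (Z : {RV P >-> R}) (G : nat -> {RV P >-> R})
    (L : {RV P >-> R}) : Prop :=
  {ae P, forall w,
     (fun n => sigma H W * Z w + \sum_(0 <= i < n) lam i * (G i w ^+ 2 - 1))
       @ \oo --> L w}.

Definition cvg_in_law (X : nat -> T -> R) (nu : set R -> \bar R) : Prop :=
  forall x : R, {for x, continuous (fun y : R => nu `]-oo, y]%classic)} ->
    (fun n => P [set w | X n w <= x]) @ \oo --> nu `]-oo, x]%classic.

End Probability.

Definition nondegenerate_law (R : realType) (nu : set R -> \bar R) : Prop :=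
  ~ exists c : R, nu [set c] = 1%E.

(* Main.v *)
Require Import Defs.
From HB Require Import structures.
From mathcomp Require Import all_boot all_order all_fingroup all_algebra.
From mathcomp Require Import all_classical all_reals all_analysis.
From mathcomp Require Import measurable_realfun zify ring lra.
Import Order.TTheory GRing.Theory Num.Theory.
Import numFieldNormedType.Exports.
Local Open Scope classical_set_scope.
Local Open Scope ring_scope.

(**
  If the limit [sigma Z + sum_i lam_i (Z_i^2 - 1)] is a.s. constant, then every
  single Gaussian with a non-zero coefficient is a.s. determined by the others,
  of which it is independent; hence [sigma = 0] and [lam = 0].

  With [d] the degree function of [W], [sigma^2] is a sum of integrals
  [t(H (-) H) - t(H (+) H) >= 0], one of which is
  [int W (1 - W) d(x)^2 dx dy]; so [sigma = 0] forces [W (1 - W) d(x)^2 = 0]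
  a.e.  The kernel of the 2-star is, up to a factor,
  [K + c] with [K = W(x,y)(d(x) + d(y)) + int W(x,z) W(y,z) dz - c] and
  [c = 3 t > 0], and regularity says that the constants are in the kernel of
  the operator [K].  If [K <> 0], it has an eigenfunction for a non-zero
  eigenvalue, orthogonal to the constants, which gives a non-zero element of
  Spec^-; so [lam = 0] forces [W(x,y)(d(x) + d(y)) + int W(x,z) W(y,z) dz = c]
  a.e.  Where [W(x,y) = 0] this yields [c <= d(x)], and where [W(x,z) = 1] it
  yields [d(x) + d(z) <= c]; so if [W(x,.)] is not a.e. 1, all neighbours [z]
  of [x] have [d(z) = 0], which only happens for a null set of pairs, and
  [W(x,.) = 0] a.e., contradicting [c <= d(x)].

  The eigenfunction of [K] is a column of the uniform limit of
  [K^(2n) / rho^n], where [rho] is the growth rate of the Hilbert-Schmidt norms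
  [tr K^(2n)]: these are log-convex, so that [rho] exists, and
  submultiplicative, so that [tr K^(2n) >= rho^n] and the limit is not 0.
*)

Set Implicit Arguments.
Unset Strict Implicit.

(** * Integrals of bounded measurable functions over a probability space *)

(** Boundedness everywhere, rather than almost everywhere, is inherited by slices and compositions,
    and it makes integrability over a probability space automatic. *)
Definition bounded_measurable {d} {T : measurableType d} {R : realType}
    (f : T -> R) : Prop :=
  measurable_fun setT f /\ exists M : R, forall x, `|f x| <= M.

Section BoundedMeasurable.
Context {d} {T : measurableType d} {R : realType}.
Implicit Types f g : T -> R.

Lemma bounded_measurable_cst (c : R) : bounded_measurable (fun _ : T => c).
Proof. by split; [exact: measurable_cst|exists `|c|]. Qed.

Lemma bounded_measurableD f g : bounded_measurable f -> bounded_measurable g ->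
  bounded_measurable (fun x => f x + g x).
Proof.
move=> [mf [a fa]] [mg [b gb]]; split; first exact: measurable_funD.
by exists (a + b) => x; rewrite (le_trans (ler_normD _ _))// lerD.
Qed.

Lemma bounded_measurableM f g : bounded_measurable f -> bounded_measurable g ->
  bounded_measurable (fun x => f x * g x).
Proof.
move=> [mf [a fa]] [mg [b gb]]; split; first exact: measurable_funM.
by exists (a * b) => x; rewrite normrM ler_pM.
Qed.

Lemma bounded_measurableN f : bounded_measurable f ->
  bounded_measurable (fun x => - f x).
Proof.
move=> [mf [a fa]]; split; first exact: measurableT_comp.
by exists a => x; rewrite normrN.
Qed.

Lemma bounded_measurableX f n : bounded_measurable f ->
  bounded_measurable (fun x => f x ^+ n).
Proof.
move=> [mf [a fa]]; split; first exact: measurable_funX.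
by exists (a ^+ n) => x; rewrite normrX lerXn2r// nnegrE (le_trans _ (fa x)).
Qed.

Lemma bounded_measurable_norm f : bounded_measurable f ->
  bounded_measurable (fun x => `|f x|).
Proof.
move=> [mf [a fa]]; split; first exact: measurableT_comp.
by exists a => x; rewrite normr_id.
Qed.

Lemma bounded_measurable_comp d' (S : measurableType d') (f : S -> R)
    (g : T -> S) : bounded_measurable f -> measurable_fun setT g ->
  bounded_measurable (fun x => f (g x)).
Proof.
by move=> [mf [a fa]] mg; split; [exact: measurableT_comp|exists a => x].
Qed.

Lemma bounded_measurable_indic (A : set T) : measurable A ->
  bounded_measurable (\1_A : T -> R).
Proof.
move=> mA; split; first exact: measurable_indic.
by exists 1 => x; rewrite indicE; case: (_ \in _); rewrite ?normr1 ?normr0.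
Qed.

End BoundedMeasurable.

Section Integral.
Context {d} {X : measurableType d} {R : realType} (m : probability X R).
Implicit Types f g : X -> R.

Lemma bounded_measurable_integrable f : bounded_measurable f ->
  m.-integrable setT (EFin \o f).
Proof.
move=> [mf [M fM]]; apply: measurable_bounded_integrable => //.
  by rewrite (le_lt_trans (probability_le1 _ _)) ?ltry.
exists M; split; first exact: num_real.
by move=> A MA x _; apply: le_trans (fM x) (ltW MA).
Qed.
Local Notation bmi := bounded_measurable_integrable.

Lemma eq_integralT f g : (forall x, f x = g x) ->
  \int[m]_x f x = \int[m]_x g x.
Proof. by move=> /funext ->. Qed.

Lemma integralT_cst (c : R) : \int[m]_(_ in setT) c = c.
Proof. by rewrite Rintegral_cst//= probability_setT mulr1. Qed.

Lemma integralTD f g : bounded_measurable f -> bounded_measurable g ->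
  \int[m]_x (f x + g x) = \int[m]_x f x + \int[m]_x g x.
Proof. by move=> /bmi bf /bmi bg; rewrite RintegralD. Qed.

Lemma integralTB f g : bounded_measurable f -> bounded_measurable g ->
  \int[m]_x (f x - g x) = \int[m]_x f x - \int[m]_x g x.
Proof. by move=> /bmi bf /bmi bg; rewrite RintegralB. Qed.

Lemma integralTZl (c : R) f : bounded_measurable f ->
  \int[m]_x (c * f x) = c * \int[m]_x f x.
Proof. by move=> /bmi bf; rewrite RintegralZl. Qed.

Lemma integralTZr (c : R) f : bounded_measurable f ->
  \int[m]_x (f x * c) = (\int[m]_x f x) * c.
Proof. by move=> /bmi bf; rewrite RintegralZr. Qed.

Lemma le_integralT f g : bounded_measurable f -> bounded_measurable g ->
  (forall x, f x <= g x) -> \int[m]_x f x <= \int[m]_x g x.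
Proof. by move=> /bmi bf /bmi bg fg; apply: le_Rintegral. Qed.

Lemma integralT_ge0 f : (forall x, 0 <= f x) -> 0 <= \int[m]_x f x.
Proof. by move=> f0; apply: Rintegral_ge0. Qed.

Lemma le_norm_integralT f : bounded_measurable f ->
  `|\int[m]_x f x| <= \int[m]_x `|f x|.
Proof. by move=> /bmi bf; apply: le_normr_Rintegral. Qed.

Lemma norm_integralT_le f (M : R) : bounded_measurable f ->
  (forall x, `|f x| <= M) -> `|\int[m]_x f x| <= M.
Proof.
move=> bf fM; rewrite (le_trans (le_norm_integralT bf))// -[leRHS]integralT_cst.
apply: le_integralT => //; last exact: bounded_measurable_cst.
exact: bounded_measurable_norm.
Qed.

End Integral.

Definition bounded_measurable2 {d d'} {S : measurableType d}
    {T : measurableType d'} {R : realType} (K : S -> T -> R) : Prop :=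
  bounded_measurable (fun p : S * T => K p.1 p.2).

Lemma bounded_measurable2_comp {d d' d''} {S : measurableType d}
    {T : measurableType d'} {U : measurableType d''} {R : realType}
    (K : S -> T -> R) (a : U -> S) (b : U -> T) : bounded_measurable2 K ->
  measurable_fun setT a -> measurable_fun setT b ->
  bounded_measurable (fun u => K (a u) (b u)).
Proof.
move=> bK ma mb.
exact: (@bounded_measurable_comp _ _ _ _ _ (fun p => K p.1 p.2)
  (fun u => (a u, b u)) bK (measurable_fun_pair ma mb)).
Qed.

Section ParametricIntegral.
Context {d d'} {S : measurableType d} {X : measurableType d'} {R : realType}.
Variable m : probability X R.

Lemma bounded_measurable_integralT (K : S -> X -> R) : bounded_measurable2 K ->
  bounded_measurable (fun s => \int[m]_x K s x).
Proof.
move=> bK; have [mK [M KM]] := bK.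
have bKs s : bounded_measurable (K s) by apply: (bounded_measurable2_comp bK).
split; last first.
  exists M => s; apply: norm_integralT_le => // x; exact: (KM (s, x)).
(* Tonelli's theorem needs a non-negative integrand, hence the shift by the bound [M]. *)
have -> : (fun s => \int[m]_x K s x) = (fun s => \int[m]_x (K s x + M) - M).
  apply/funext => s; rewrite integralTD//; last exact: bounded_measurable_cst.
  by rewrite integralT_cst addrK.
apply: measurable_funB => //.
rewrite /Rintegral.
apply: (measurableT_comp (fine_measurable measurableT)).
apply: (@measurable_fun_fubini_tonelli_F _ _ S X R m
  (fun p => (K p.1 p.2 + M)%:E)).
  by apply/measurable_EFinP; apply: measurable_funD.
by move=> p; rewrite lee_fin -lerBlDr sub0r; have := KM p;
  rewrite ler_norml => /andP[].
Qed.

End ParametricIntegral.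

Ltac measurable_coordinate :=
  repeat first
    [ assumption
    | exact: measurable_id
    | exact: measurable_cst
    | exact: measurable_fst
    | exact: measurable_snd
    | apply: (measurableT_comp measurable_fst)
    | apply: (measurableT_comp measurable_snd) ].

(** Recursion on the shape of the integrand: the leaves are functions and kernels from the context
    evaluated at coordinates, and an inner integral is a function of its parameters. *)
Ltac bounded_meas :=
  repeat first
    [ assumption
    | exact: bounded_measurable_cst
    | apply: bounded_measurableD
    | apply: bounded_measurableN
    | apply: bounded_measurableM
    | apply: bounded_measurableX
    | apply: bounded_measurable_norm
    | apply: bounded_measurable_integralT; rewrite /bounded_measurable2
    | match goal with H : bounded_measurable2 _ |- _ =>
        apply: (bounded_measurable2_comp H); solve [measurable_coordinate] end
    | match goal with H : bounded_measurable _ |- _ =>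
        apply: (bounded_measurable_comp H); solve [measurable_coordinate] end ].

Section IntegralInequalities.
Context {d} {X : measurableType d} {R : realType} (m : probability X R).
Implicit Types f g : X -> R.
Local Notation bmi := (bounded_measurable_integrable m).

Lemma integralT_eq0_ae f : bounded_measurable f -> (forall x, 0 <= f x) ->
  \int[m]_x f x = 0 -> {ae m, forall x, f x = 0}.
Proof.
move=> bf f0 If0; have := bmi bf => /integrableP[mf _].
have /(ae_eq_integral_abs m measurableT mf)/= : (\int[m]_x `|(EFin \o f) x| =
  0)%E.
  rewrite -[RHS]/(0%:E) -If0 /Rintegral fineK; last first.
    by apply: integrable_fin_num => //; exact: bmi.
  by apply: eq_integral => x _ /=; rewrite ger0_norm.
by apply: filterS => x /(_ I)[].
Qed.

Lemma ae_eq_integralT f g : bounded_measurable f -> bounded_measurable g ->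
  {ae m, forall x, f x = g x} -> \int[m]_x f x = \int[m]_x g x.
Proof.
move=> [mf _] [mg _] fg; congr fine; apply: ae_eq_integral => //.
- exact/measurable_EFinP.
- exact/measurable_EFinP.
- by apply: filterS fg => x + _ => ->.
Qed.

Lemma cauchy_schwarz_integralT f g :
  bounded_measurable f -> bounded_measurable g ->
  (\int[m]_x (f x * g x)) ^+ 2 <=
  (\int[m]_x (f x ^+ 2)) * (\int[m]_x (g x ^+ 2)).
Proof.
move=> bf bg.
set A := \int[m]_x (f x ^+ 2); set B := \int[m]_x (f x * g x).
set C := \int[m]_x (g x ^+ 2).
have quad (s u : R) : 0 <= s ^+ 2 * A - 2 * s * u * B + u ^+ 2 * C.
  have <- : \int[m]_x ((s * f x - u * g x) ^+ 2) =
      s ^+ 2 * A - 2 * s * u * B + u ^+ 2 * C.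
    rewrite -!integralTZl -?integralTB -?integralTD; try by bounded_meas.
    by apply: eq_integralT => x; ring.
  by apply: integralT_ge0 => x; exact: sqr_ge0.
have A0 : 0 <= A by apply: integralT_ge0 => x; exact: sqr_ge0.
(* At [(s, u) = (B, A)] the quadratic form equals [A * (A * C - B ^+ 2)]. If [A = 0] and [B] is
   non-zero, the form is affine in [s] and takes the value [-1] at the point chosen below. *)
have [A_gt0|] := ltP 0 A.
  have := quad B A; have -> : B ^+ 2 * A - 2 * B * A * B + A ^+ 2 * C =
    A * (A * C - B ^+ 2) by ring.
  by rewrite pmulr_rge0// subr_ge0.
move=> A_le0; have {A_le0 A0}A0 : A = 0 by apply: le_anti; rewrite A_le0.
rewrite A0 mul0r.
have [->|B0] := eqVneq B 0; first by rewrite expr0n.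
have := quad ((C + 1) / (2 * B)) 1.
rewrite A0; have -> : ((C + 1) / (2 * B)) ^+ 2 * 0 - 2 * ((C + 1) / (2 * B)) * 1 * B
  + 1 ^+ 2 * C = - 1 by field.
by rewrite ler0N1.
Qed.

Lemma bounded_cvg_integralT (f_ : nat -> X -> R) f (M : R) :
  (forall n, measurable_fun setT (f_ n)) -> (forall n x, `|f_ n x| <= M) ->
  (forall x, (fun n => f_ n x) @ \oo --> f x) ->
  (fun n => \int[m]_x f_ n x) @ \oo --> \int[m]_x f x.
Proof.
move=> mf_ fM cf.
have mf : measurable_fun setT f by apply: (measurable_fun_cvg mf_) => x _.
have bM : m.-integrable setT (EFin \o (fun=> M)).
  by apply: bmi; exact: bounded_measurable_cst.
have [] := @dominated_convergence _ X R m setT measurableT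
  (fun n => EFin \o f_ n) (EFin \o f) (EFin \o (fun=> M)) _ _ _ bM _.
- by move=> n; exact/measurable_EFinP.
- exact/measurable_EFinP.
- apply: aeW => x _; apply: cvg_EFin; first by near=> n.
  exact: cf.
- by apply: aeW => x n _ /=; rewrite lee_fin.
move=> If _ cvgI.
apply: fine_cvg; rewrite fineK; first exact: cvgI.
exact: integrable_fin_num.
Unshelve. all: by end_near. Qed.

End IntegralInequalities.

Section Fubini.
Context {d} {X : measurableType d} {R : realType} (m : probability X R).
Implicit Types K : X -> X -> R.

Lemma prod_probability_integral K : bounded_measurable2 K ->
  \int[m]_x \int[m]_y K x y = \int[(m \x m)%E]_p K p.1 p.2.
Proof.
move=> bK.
have bKs x : bounded_measurable (K x) by apply: (bounded_measurable2_comp bK).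
have := @integral12_prod_meas1 _ _ X X R m m (fun p => (K p.1 p.2)%:E).
rewrite /fubini_F /= =>
  /(_ (bounded_measurable_integrable _ bK))/(congr1 fine) E.
apply: (eq_trans _ E); congr fine; apply: eq_integral => x _; rewrite fineK//.
by apply: integrable_fin_num => //; exact: bounded_measurable_integrable.
Qed.

Lemma integralT_swap K : bounded_measurable2 K ->
  \int[m]_x \int[m]_y K x y = \int[m]_y \int[m]_x K x y.
Proof.
move=> bK.
have bK1 x : bounded_measurable (K x) by apply: (bounded_measurable2_comp bK).
have bK2 x : bounded_measurable (K^~ x).
  by apply: (bounded_measurable2_comp bK).
have := @Fubini _ _ X X R m m (fun p => (K p.1 p.2)%:E)
  (bounded_measurable_integrable _ bK) => /(congr1 fine)/=.
have E h : (forall x, bounded_measurable (h x)) ->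
    fine (\int[m]_x \int[m]_y (h x y)%:E) = \int[m]_x \int[m]_y (h x y : R).
  move=> bh; congr fine; apply: eq_integral => x _; rewrite fineK//.
  by apply: integrable_fin_num => //; exact: bounded_measurable_integrable.
by rewrite E// E.
Qed.

Lemma integral2_eq0_ae K : bounded_measurable2 K -> (forall x y, 0 <= K x y) ->
  \int[m]_x \int[m]_y K x y = 0 ->
  {ae m, forall x, {ae m, forall y, K x y = 0}}.
Proof.
move=> bK K0 /integralT_eq0_ae.
have bi : bounded_measurable (fun x => \int[m]_y K x y) by bounded_meas.
move=> /(_ bi (fun x => integralT_ge0 _ _)) H.
have {H} : {ae m, forall x, \int[m]_y K x y = 0} by apply: H.
apply: filterS => x; apply: integralT_eq0_ae => //.
by bounded_meas.
Qed.

Lemma cauchy_schwarz_integral2 K L : bounded_measurable2 K ->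
  bounded_measurable2 L ->
  (\int[m]_x \int[m]_y (K x y * L x y)) ^+ 2 <=
  (\int[m]_x \int[m]_y (K x y ^+ 2)) * (\int[m]_x \int[m]_y (L x y ^+ 2)).
Proof.
move=> bK bL.
rewrite (@prod_probability_integral (fun x y => K x y * L x y)); last first.
  by rewrite /bounded_measurable2; bounded_meas.
rewrite (@prod_probability_integral (fun x y => K x y ^+ 2)); last first.
  by rewrite /bounded_measurable2; bounded_meas.
rewrite (@prod_probability_integral (fun x y => L x y ^+ 2)); last first.
  by rewrite /bounded_measurable2; bounded_meas.
exact: cauchy_schwarz_integralT.
Qed.

End Fubini.

Lemma ae_mono {d} {T : measurableType d} {R : realType}
    (mu : {measure set T -> \bar R}) (Q Q' : T -> Prop) :
  (forall x, Q x -> Q' x) -> {ae mu, forall x, Q x} -> {ae mu, forall x, Q' x}.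
Proof. by move=> QQ'; apply: filterS => x; exact: QQ'. Qed.

Lemma ae_mono2 {d} {T : measurableType d} {R : realType}
    (mu : {measure set T -> \bar R}) (Q1 Q2 Q' : T -> Prop) :
  (forall x, Q1 x -> Q2 x -> Q' x) ->
  {ae mu, forall x, Q1 x} -> {ae mu, forall x, Q2 x} -> {ae mu, forall x, Q' x}.
Proof. by move=> QQ'; apply: filterS2 => x; exact: QQ'. Qed.

(** * Eigenfunctions of symmetric kernels *)

(** Log-convexity makes the ratios of consecutive terms non-decreasing, and submultiplicativity
    bounds them by [u 0]; [rho] is their limit. The exponent is [k.+1] because [u k] will be the
    squared norm of the [k.+1]-st power of an operator. *)
Lemma log_convex_submultiplicative_growth (R : realType) (u : nat -> R) :
  (forall k, 0 < u k) -> (forall k, u k.+1 ^+ 2 <= u k * u k.+2) ->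
  (forall i j, u (i + j).+1 <= u i * u j) ->
  exists2 rho : R, 0 < rho &
    [/\ forall k, 1 <= u k / rho ^+ k.+1,
        nonincreasing_seq (fun k => u k / rho ^+ k.+1) &
        cvgn (fun k => u k / rho ^+ k.+1)].
Proof.
move=> u0 logconvex submul.
pose q k := u k.+1 / u k.
have q0 k : 0 < q k by rewrite divr_gt0.
have nd_q : nondecreasing_seq q.
  apply/nondecreasing_seqP => k.
  by rewrite /q ler_pdivrMr// mulrAC ler_pdivlMr// -expr2 mulrC logconvex.
have q_ub k : q k <= u 0%N.
  by rewrite /q ler_pdivrMr// mulrC -[in leLHS](addn0 k) submul.
have cvg_q : cvgn q.
  apply: nondecreasing_is_cvgn => //; exists (u 0%N) => _ [k _ <-] //.
pose rho := limn q.
have q_le k : q k <= rho by exact: nondecreasing_cvgn_le.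
have rho0 : 0 < rho by rewrite (lt_le_trans (q0 0%N)).
(* The quotient is a product of [i] consecutive ratios, each tending to [rho]. *)
have cvg_ratio i : (fun j => u (j + i)%N / u j) @ \oo --> rho ^+ i.
  elim: i => [|i IHi].
    under eq_fun do rewrite addn0 divff ?gt_eqF//.
    exact: cvg_cst.
  rewrite exprSr.
  have -> : (fun j => u (j + i.+1)%N / u j) =
      (fun j => u (j + i)%N / u j * q (j + i)%N).
    apply/funext => j; rewrite /q addnS.
    have := u0 j; have := u0 (j + i)%N.
    by move=> *; field; rewrite !gt_eqF.
  by apply: cvgM => //; rewrite (cvg_shiftn i q).
(* Submultiplicativity is divided by [u j], and [j] tends to infinity. *)
have lower i : rho ^+ i.+1 <= u i.
  rewrite -(cvg_lim (@Rhausdorff R) (cvg_ratio i.+1)).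
  apply: limr_le; first by apply/cvg_ex; exists (rho ^+ i.+1).
  by near=> j; rewrite ler_pdivrMr// addnS addnC submul.
have a_noninc : nonincreasing_seq (fun k => u k / rho ^+ k.+1).
  apply/nonincreasing_seqP => k.
  rewrite [in leLHS]exprS invfM mulrA ler_pM2r ?invr_gt0 ?exprn_gt0//.
  rewrite ler_pdivrMr//.
  by have := q_le k; rewrite /q ler_pdivrMr// mulrC.
have a_ge1 k : 1 <= u k / rho ^+ k.+1.
  by rewrite ler_pdivlMr ?exprn_gt0// mul1r.
exists rho => //; split => //.
apply: nonincreasing_is_cvgn => //.
by exists 1 => _ [k _ <-] /=.
Unshelve. all: by end_near. Qed.

(** * Composition, powers and Hilbert-Schmidt norms of kernels *)

Section Kernels.
Context {d} {X : measurableType d} {R : realType} (m : probability X R).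
Implicit Types K L N : X -> X -> R.

Definition kernel_comp K L (x y : X) : R := \int[m]_z (K x z * L z y).

(* [kernel_iter K n] is the kernel of the [n.+1]-st power of the operator. *)
Fixpoint kernel_iter K (n : nat) : X -> X -> R :=
  if n is n'.+1 then kernel_comp K (kernel_iter K n') else K.

Definition kernel_trace K : R := \int[m]_x K x x.

Definition kernel_norm2 K : R := \int[m]_x \int[m]_y (K x y ^+ 2).

Lemma bounded_measurable2_comp_kernel K L :
  bounded_measurable2 K -> bounded_measurable2 L ->
  bounded_measurable2 (kernel_comp K L).
Proof. by move=> bK bL; rewrite /bounded_measurable2/kernel_comp;
  bounded_meas. Qed.

Lemma bounded_measurable2_iter K n : bounded_measurable2 K ->
  bounded_measurable2 (kernel_iter K n).
Proof. by move=> bK; elim: n => //= n;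
  exact: bounded_measurable2_comp_kernel. Qed.

Lemma kernel_compA K L N : bounded_measurable2 K -> bounded_measurable2 L ->
  bounded_measurable2 N ->
  kernel_comp (kernel_comp K L) N = kernel_comp K (kernel_comp L N).
Proof.
move=> bK bL bN; apply/funext => x; apply/funext => y; rewrite /kernel_comp.
transitivity (\int[m]_z \int[m]_w (K x w * L w z * N z y)).
  by apply: eq_integralT => z; rewrite integralTZr//; bounded_meas.
rewrite integralT_swap; last by rewrite /bounded_measurable2; bounded_meas.
apply: eq_integralT => w; rewrite -integralTZl; last by bounded_meas.
by apply: eq_integralT => z; rewrite mulrA.
Qed.

Lemma kernel_comp_iter K i j : bounded_measurable2 K ->
  kernel_comp (kernel_iter K i) (kernel_iter K j) = kernel_iter K (i + j).+1.
Proof.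
move=> bK; elim: i => // i IHi.
rewrite [in LHS]/= kernel_compA ?IHi//; exact: bounded_measurable2_iter.
Qed.

(** [K] commutes with its powers: the last factor is split off on one side of the equation and the
    first factor on the other. *)
Lemma kernel_iter_sym K n : bounded_measurable2 K ->
  (forall x y, K x y = K y x) ->
  forall x y, kernel_iter K n x y = kernel_iter K n y x.
Proof.
move=> bK symK; elim: n => // n IHn x y.
rewrite -[LHS]/(kernel_iter K n.+1 x y) -[in LHS](addn0 n) -kernel_comp_iter//.
by apply: eq_integralT => z /=; rewrite mulrC IHn symK.
Qed.

(** By symmetry the inner integral is a diagonal value of the composed kernel. Hence the inner
    product of two powers depends only on the sum of their exponents. *)
Lemma kernel_iter_inner K i j : bounded_measurable2 K ->
  (forall x y, K x y = K y x) ->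
  \int[m]_x \int[m]_y (kernel_iter K i x y * kernel_iter K j x y) =
  kernel_trace (kernel_iter K (i + j).+1).
Proof.
move=> bK symK; rewrite -kernel_comp_iter//.
apply: eq_integralT => x; apply: eq_integralT => y.
by rewrite (kernel_iter_sym j bK symK).
Qed.

(** Cauchy-Schwarz in the intermediate variable bounds the squared composition pointwise by
    [A x * B y], whose double integral factors. *)
Lemma kernel_norm2_comp K L : bounded_measurable2 K -> bounded_measurable2 L ->
  kernel_norm2 (kernel_comp K L) <= kernel_norm2 K * kernel_norm2 L.
Proof.
move=> bK bL.
pose A x := \int[m]_z (K x z ^+ 2); pose B y := \int[m]_z (L z y ^+ 2).
have bA : bounded_measurable A by rewrite /A; bounded_meas.
have bB : bounded_measurable B by rewrite /B; bounded_meas.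
have bKL := bounded_measurable2_comp_kernel bK bL.
have -> : kernel_norm2 K * kernel_norm2 L = \int[m]_x \int[m]_y (A x * B y).
  have -> : kernel_norm2 L = \int[m]_y B y.
    rewrite /kernel_norm2 integralT_swap//.
    by rewrite /bounded_measurable2; bounded_meas.
  rewrite -integralTZr//; apply: eq_integralT => x.
  by rewrite integralTZl.
apply: le_integralT; [by bounded_meas|by bounded_meas|] => x.
apply: le_integralT; [by bounded_meas|by bounded_meas|] => y.
by apply: cauchy_schwarz_integralT; bounded_meas.
Qed.

End Kernels.

Section DensityMeasure.
Context {d} {T : measurableType d} {R : realType} (mu : {measure set T ->
  \bar R}).
Variables (f : T -> R) (mf : measurable_fun setT f) (f_ge0 : forall x, 0 <= f x).

(** The two proofs are carried as arguments so that the measure structure declared below, which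
    depends on them, can be inferred from the term. *)
Definition density_measure of measurable_fun setT f & (forall x, 0 <= f x) :=
  fun A : set T => (\int[mu]_(x in A) (f x)%:E)%E.

Local Notation nu := (density_measure mf f_ge0).

Let density_measure0 : nu set0 = 0%E.
Proof. exact: integral_set0. Qed.

Let density_measure_ge0 A : (0 <= nu A)%E.
Proof. by apply: integral_ge0 => x _; rewrite lee_fin. Qed.

Let density_measure_sigma_additive : semi_sigma_additive nu.
Proof.
move=> F mF tF mUF; rewrite /density_measure; apply: cvg_toP.
  apply: ereal_nondecreasing_is_cvgn => i j ij.
  by apply: lee_sum_nneg_natr => // k _ _; exact: density_measure_ge0.
rewrite ge0_integral_bigcup//=; last by move=> x _; rewrite lee_fin.
by apply: measurable_funTS; exact/measurable_EFinP.
Qed.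

HB.instance Definition _ := isMeasure.Build _ _ _ nu
  density_measure0 density_measure_ge0 density_measure_sigma_additive.

End DensityMeasure.

(** * Integral operators, and kernels vanishing on rectangles *)

Section Operator.
Context {d} {X : measurableType d} {R : realType} (m : probability X R).
Implicit Types (K L : X -> X -> R) (f g : X -> R).

Definition kernel_app K f (x : X) : R := \int[m]_y (K x y * f y).

Lemma bounded_measurable_app K f : bounded_measurable2 K ->
  bounded_measurable f -> bounded_measurable (kernel_app K f).
Proof. by move=> bK bf; rewrite /kernel_app; bounded_meas. Qed.

Lemma kernel_app_comp K L f : bounded_measurable2 K -> bounded_measurable2 L ->
  bounded_measurable f ->
  kernel_app (kernel_comp m K L) f = kernel_app K (kernel_app L f).
Proof.
(* Viewing [f] as a kernel constant in its second variable reduces the claim to associativity of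
   composition. *)
move=> bK bL bf; have bN : bounded_measurable2 (fun x (_ : X) => f x).
  exact: (bounded_measurable_comp bf measurable_fst).
apply/funext => x.
exact: (congr1 (fun h => h x x) (kernel_compA m bK bL bN)).
Qed.

Lemma kernel_app_adjoint K f g : bounded_measurable2 K ->
  (forall x y, K x y = K y x) -> bounded_measurable f -> bounded_measurable g ->
  \int[m]_x (f x * kernel_app K g x) = \int[m]_x (kernel_app K f x * g x).
Proof.
move=> bK symK bf bg; rewrite /kernel_app.
transitivity (\int[m]_x \int[m]_y (f x * (K x y * g y))).
  by apply: eq_integralT => x; rewrite integralTZl//; bounded_meas.
rewrite integralT_swap; last by rewrite /bounded_measurable2; bounded_meas.
apply: eq_integralT => y; rewrite -integralTZr; last by bounded_meas.
by apply: eq_integralT => x; rewrite (symK x) mulrCA mulrA.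
Qed.

(* If [M] bounds [|K|], the measure with density [(K + M) / M] coincides with
   [m \x m] on rectangles, hence everywhere. *)
Lemma kernel_rectangles_eq0 K : bounded_measurable2 K ->
  (forall A B, measurable A -> measurable B ->
    \int[m]_x (\1_A x * kernel_app K \1_B x) = 0) ->
  kernel_norm2 m K = 0.
Proof.
move=> bK rect0; have [mK [M0 KM0]] := bK.
pose M := `|M0| + 1; have M_gt0 : 0 < M by rewrite ltr_wpDl.
have KM p : `|K p.1 p.2| <= M.
  by rewrite (le_trans (KM0 p))// (le_trans (ler_norm _))// lerDl.
pose f p : R := (K p.1 p.2 + M) / M.
have bf : bounded_measurable f by rewrite /f; bounded_meas.
have f_ge0 p : 0 <= f p.
  by rewrite divr_ge0 ?(ltW M_gt0)// -lerBlDr sub0r; have := KM p;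
    rewrite ler_norml => /andP[].
have [mf _] := bf.
have fI := bounded_measurable_integrable (m \x m)%E bf.
have rect A B : measurable A -> measurable B ->
    density_measure (m \x m)%E mf f_ge0 (A `*` B) = (m A * m B)%E.
  move=> mA mB; rewrite /density_measure.
  have bA := bounded_measurable_indic (R := R) mA.
  have bB := bounded_measurable_indic (R := R) mB.
  have -> : (\int[(m \x m)%E]_(x in A `*` B) (f x)%:E =
      \int[(m \x m)%E]_p (f p * (\1_A p.1 * \1_B p.2))%:E)%E.
    rewrite integral_mkcond; apply: eq_integral => -[x y] _.
    rewrite patchE !indicE in_setX/=.
    by case: (x \in A); case: (y \in B); rewrite /= ?mulr1 ?mulr0.
  have bfAB : bounded_measurable2 (fun x y => f (x, y) * (\1_A x * \1_B y)).
    rewrite /bounded_measurable2; apply: bounded_measurableM;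
      last by bounded_meas.
    by rewrite /f/=; bounded_meas.
  rewrite -[LHS]fineK; last first.
    apply: integrable_fin_num => //.
    have := bounded_measurable_integrable (m \x m)%E bfAB.
    by apply: eq_integrable => // -[x y] _.
  rewrite -(fineK (fin_num_measure m A mA)) -(fineK (fin_num_measure m B mB)).
  rewrite -EFinM; congr (_%:E).
  transitivity (\int[m]_x \int[m]_y (f (x, y) * (\1_A x * \1_B y))).
    by rewrite prod_probability_integral.
  (* [f] is [K / M + 1]: the first part integrates to 0 over the rectangle by [rect0], and the
     second contributes [m A * m B]. *)
  transitivity (M^-1 * \int[m]_x (\1_A x * kernel_app K \1_B x) +
      \int[m]_x (\1_A x * \int[m]_y (\1_B y))).
    have bKB := bounded_measurable_app bK bB.
    rewrite -integralTZl; last by bounded_meas.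
    rewrite -integralTD; [|by bounded_meas|by bounded_meas].
    apply: eq_integralT => x.
    rewrite -!integralTZl; [|by bounded_meas..].
    rewrite -integralTD; [|by bounded_meas|by bounded_meas].
    apply: eq_integralT => y; rewrite /f /=.
    by field; rewrite gt_eqF.
  rewrite rect0// mulr0 add0r integralTZr//.
  by congr (_ * _); rewrite /Rintegral integral_indic// setIT.
have fE S : measurable S -> (m \x m)%E S =
  density_measure (m \x m)%E mf f_ge0 S.
  exact: product_measure_unique rect S.
(* [f] and the constant 1 are densities of the same measure, hence equal almost everywhere. *)
have f1 : {ae (m \x m)%E, forall p, f p = 1}.
  have H : ae_eq (m \x m)%E setT (EFin \o f) (cst 1%E).
    apply: integral_ae_eq => // S _ mS.
    by rewrite integral_cst// mul1e -[RHS]/((m \x m)%E S) fE.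
  by apply: filterS H => p /(_ I) [].
rewrite /kernel_norm2 (prod_probability_integral m (K := fun x y =>
  K x y ^+ 2)).
  rewrite -[RHS](integralT_cst (m \x m)%E); apply: ae_eq_integralT.
  - by bounded_meas.
  - by bounded_meas.
  - apply: filterS f1 => p; rewrite /f => /(congr1 (fun r => r * M)).
    rewrite divfK ?gt_eqF// mul1r => /(congr1 (fun r => r - M)).
    by rewrite addrK subrr => ->; rewrite expr0n.
by rewrite /bounded_measurable2; bounded_meas.
Qed.

End Operator.

(** * Existence of an eigenfunction by power iteration *)

Section SpectralTheorem.
Context {d} {X : measurableType d} {R : realType} (m : probability X R).
Implicit Types (K L : X -> X -> R) (f g : X -> R).

Lemma kernel_norm2_ge0 K : 0 <= kernel_norm2 m K.
Proof. by apply: integralT_ge0 => x; apply: integralT_ge0 => y;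
  exact: sqr_ge0. Qed.

(** If [K] composed with itself vanishes, then the squared norm of [K] applied to [\1_B], which is
    the quadratic form of that square at [\1_B], is 0. So [K] integrates to 0 over every
    rectangle. *)
Lemma kernel_norm2_square_neq0 K : bounded_measurable2 K ->
  (forall x y, K x y = K y x) -> kernel_norm2 m K != 0 ->
  kernel_norm2 m (kernel_comp m K K) != 0.
Proof.
move=> bK symK; apply: contra_neq => KK0;
  apply: kernel_rectangles_eq0 => // A B mA mB.
have bA := bounded_measurable_indic (R := R) mA.
have bB := bounded_measurable_indic (R := R) mB.
have bKB := bounded_measurable_app m bK bB.
have bKK := bounded_measurable2_comp_kernel m bK bK.
have KB0 : \int[m]_x (kernel_app m K \1_B x ^+ 2) = 0.
  have -> : \int[m]_x (kernel_app m K \1_B x ^+ 2) =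
      \int[m]_x \int[m]_y (kernel_comp m K K x y * (\1_B x * \1_B y)).
    transitivity (\int[m]_x (\1_B x * kernel_app m K (kernel_app m K \1_B) x)).
      by rewrite [RHS]kernel_app_adjoint.
    rewrite -kernel_app_comp//. apply: eq_integralT => x.
    rewrite -integralTZl; last by bounded_meas.
    by apply: eq_integralT => y; rewrite mulrCA.
  have bBB : bounded_measurable2 (fun x y => \1_B x * \1_B y : R).
    by rewrite /bounded_measurable2; bounded_meas.
  have := cauchy_schwarz_integral2 m bKK bBB.
  rewrite -/(kernel_norm2 m _) KK0 mul0r => h.
  by apply/eqP; rewrite -sqrf_eq0 eq_le h sqr_ge0.
have := cauchy_schwarz_integralT m bA bKB.
rewrite KB0 mulr0 => h.
by apply/eqP; rewrite -sqrf_eq0 eq_le h sqr_ge0.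
Qed.

(** Cauchy-Schwarz on the square, against [K x z * K w y]. It turns Hilbert-Schmidt convergence into
    uniform convergence. *)
Lemma kernel_sandwich_bound K L (M : R) : bounded_measurable2 K ->
  bounded_measurable2 L -> (forall x y, `|K x y| <= M) -> forall x y,
  kernel_comp m K (kernel_comp m L K) x y ^+ 2 <= M ^+ 4 * kernel_norm2 m L.
Proof.
move=> bK bL KM x y.
have -> : kernel_comp m K (kernel_comp m L K) x y =
    \int[m]_z \int[m]_w (L z w * (K x z * K w y)).
  apply: eq_integralT => z; rewrite -integralTZl; last by bounded_meas.
  by apply: eq_integralT => w; rewrite mulrCA.
have bKK : bounded_measurable2 (fun z w => K x z * K w y).
  by rewrite /bounded_measurable2; bounded_meas.
apply: (le_trans (cauchy_schwarz_integral2 m bL bKK)); rewrite mulrC.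
apply: ler_wpM2r; first exact: kernel_norm2_ge0.
have M0 : 0 <= M := le_trans (normr_ge0 _) (KM x y).
rewrite -[leRHS](integralT_cst m); apply: le_integralT;
  [by bounded_meas|by bounded_meas|].
move=> z; rewrite -[leRHS](integralT_cst m).
apply: le_integralT; [by bounded_meas|by bounded_meas|] => w.
rewrite -[leLHS](ger0_norm (sqr_ge0 _)) normrX normrM exprMn (exprD M 2 2).
by apply: ler_pM; rewrite ?exprn_ge0// lerXn2r ?nnegrE.
Qed.

(** A column [f] of the limit of the normalised even powers satisfies [K (K f) = rho * f]. With [r]
    the square root of [rho], factoring the square of [K] minus [rho] as [(K - r) (K + r)] yields an
    eigenfunction for [r] or for [- r]. *)
Theorem symmetric_kernel_eigenfunction K : bounded_measurable2 K ->
  (forall x y, K x y = K y x) -> kernel_norm2 m K != 0 ->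
  exists r f, [/\ r != 0, bounded_measurable f, \int[m]_x (f x ^+ 2) != 0 &
    {ae m, forall x, kernel_app m K f x = r * f x}].
Proof.
move=> bK symK K_neq0.
(* The powers are made opaque, with only these properties visible; [Kp n] is the kernel of the
   [n.+1]-st power. *)
have [Kp [bKp Kp0 KpS Kp_comp Kp_inner]] : exists Kp : nat -> X -> X -> R,
    [/\ forall n, bounded_measurable2 (Kp n), Kp 0%N = K,
      forall n, kernel_comp m K (Kp n) = Kp n.+1,
      forall i j, kernel_comp m (Kp i) (Kp j) = Kp (i + j).+1 &
      forall i j, \int[m]_x \int[m]_y (Kp i x y * Kp j x y) =
        kernel_trace m (Kp (i + j).+1)].
  exists (kernel_iter m K); split.
  - by move=> n; exact: bounded_measurable2_iter.
  - by [].
  - by [].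
  - by move=> i j; exact: kernel_comp_iter.
  - by move=> i j; exact: kernel_iter_inner.
have [u uE] : exists u, forall k, u k = kernel_norm2 m (Kp k) by eexists.
have innerE i j k : (i + j = k + k)%N ->
    \int[m]_x \int[m]_y (Kp i x y * Kp j x y) = u k.
  by move=> ijk; rewrite Kp_inner ijk -Kp_inner uE.
have u_logconvex k : u k.+1 ^+ 2 <= u k * u k.+2.
  rewrite -(innerE k k.+2 k.+1); last by rewrite addnS addSn.
  by rewrite !uE; exact: cauchy_schwarz_integral2.
have u_submul i j : u (i + j).+1 <= u i * u j.
  by rewrite !uE -Kp_comp; exact: kernel_norm2_comp.
have u_ge0 k : 0 <= u k by rewrite uE; exact: kernel_norm2_ge0.
(* Two consecutive terms are carried through the induction: by log-convexity, [u k.+2 = 0] would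
   force [u k.+1 = 0]. *)
have u_gt0 k : 0 < u k.
  rewrite lt_neqAle u_ge0 andbT eq_sym.
  suff : u k != 0 /\ u k.+1 != 0 by case.
  elim: k => [|k [uk uk1]].
    by rewrite !uE -KpS Kp0; split; [|exact: kernel_norm2_square_neq0].
  split; [exact: uk1|]; apply: contra_neq uk1 => uk2.
  have := u_logconvex k; rewrite uk2 mulr0 => h.
  by apply/eqP; rewrite -sqrf_eq0 eq_le h sqr_ge0.
have [rho rho_gt0 [a_ge1 a_noninc a_cvg]] :=
  log_convex_submultiplicative_growth u_gt0 u_logconvex u_submul.
pose a k := u k / rho ^+ k.+1.
pose ell := limn a.
have ell_le k : ell <= a k by exact: nonincreasing_cvgn_ge.
(* [g n] is the power of exponent [2n + 2] divided by [rho ^+ n.+1]. The inner product of [g n] and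
   [g p] is then [a (n + p).+1], so the convergence of [a] makes [g] a Cauchy sequence in norm. *)
have [g gE] : exists g : nat -> X -> X -> R,
    forall n x y, g n x y = Kp n.*2.+1 x y / rho ^+ n.+1.
  by eexists.
have bg n : bounded_measurable2 (g n).
  have bKn := bKp n.*2.+1.
  rewrite /bounded_measurable2; under eq_fun do rewrite gE.
  by bounded_meas.
have g_inner n p : \int[m]_x \int[m]_y (g n x y * g p x y) = a (n + p).+1.
  rewrite /a -(innerE n.*2.+1 p.*2.+1); last first.
    by rewrite -!addnn; lia.
  have b1 := bKp n.*2.+1; have b2 := bKp p.*2.+1.
  rewrite -integralTZr; last by bounded_meas.
  apply: eq_integralT => x; rewrite -integralTZr; last by bounded_meas.
  apply: eq_integralT => y; rewrite !gE -addSn -addnS exprD invfM; ring.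
have g_dist n p : kernel_norm2 m (fun x y => g n x y - g p x y) =
    a (n + n).+1 - 2 * a (n + p).+1 + a (p + p).+1.
  have b1 := bg n; have b2 := bg p.
  rewrite -!g_inner -!integralTZl -?integralTB -?integralTD;
    try by bounded_meas.
  apply: eq_integralT => x.
  rewrite -!integralTZl -?integralTB -?integralTD; try by bounded_meas.
  by apply: eq_integralT => y; ring.
have g_norm n : kernel_norm2 m (g n) = a (n + n).+1 by rewrite -g_inner.
have [_ [M KM]] := bK.
have {}KM x y : `|K x y| <= M by exact: (KM (x, y)).
(* A factor [K] is taken off on each side, so that [kernel_sandwich_bound] converts norm estimates
   on [g n] into pointwise estimates on [g n.+1]. *)
have gS n x y : g n.+1 x y =
    rho^-1 * kernel_comp m K (kernel_comp m (g n) K) x y.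
  have b1 := bKp n.*2.+1; have bKK := bounded_measurable2_comp_kernel m b1 bK.
  transitivity (rho^-1 * (kernel_comp m K (kernel_comp m (Kp n.*2.+1) K) x y
      / rho ^+ n.+1)).
    rewrite !gE doubleS [_ ^+ n.+2]exprS invfM mulrCA; congr (_ * (_ / _)).
    have := Kp_comp n.*2.+1 0%N; rewrite Kp0 addn0 => ->.
    by rewrite KpS.
  congr (_ * _); rewrite -integralTZr; last by bounded_meas.
  apply: eq_integralT => z; rewrite -mulrA; congr (_ * _).
  rewrite -integralTZr; last by bounded_meas.
  by apply: eq_integralT => w; rewrite gE mulrAC.
(* Here both factors [K] act on the first variable; in the limit this becomes the eigenvalue
   equation of the columns. *)
have gS2 n x y : g n.+1 x y = rho^-1 * kernel_app m (Kp 1%N) (g n ^~ y) x.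
  have b1 := bKp n.*2.+1; have b2 := bKp 1%N.
  rewrite !gE doubleS [_ ^+ n.+2]exprS invfM mulrCA; congr (_ * _).
  rewrite -[_.*2.+3]/(1 + n.*2.+1).+1 -Kp_comp.
  rewrite -integralTZr; last by bounded_meas.
  by apply: eq_integralT => z; rewrite gE mulrA.
pose C := rho ^- 2 * M ^+ 4.
have M4_ge0 : 0 <= M ^+ 4 by exact: exprn_even_ge0.
have rho2_ge0 : 0 <= rho ^- 2 by rewrite invr_ge0 exprn_ge0// ltW.
have C_ge0 : 0 <= C by exact: mulr_ge0.
have gS_dist n p x y : (g n.+1 x y - g p.+1 x y) ^+ 2 <=
    C * (a (n + n).+1 - 2 * a (n + p).+1 + a (p + p).+1).
  have b1 := bg n; have b2 := bg p.
  have bL : bounded_measurable2 (fun x y => g n x y - g p x y).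
    by rewrite /bounded_measurable2; bounded_meas.
  have -> : g n.+1 x y - g p.+1 x y = rho^-1 * kernel_comp m K
      (kernel_comp m (fun x y => g n x y - g p x y) K) x y.
    rewrite !gS -mulrBr; congr (_ * _).
    rewrite -integralTB; last 2 first.
      by rewrite /kernel_comp; bounded_meas.
      by rewrite /kernel_comp; bounded_meas.
    apply: eq_integralT => z; rewrite -mulrBr; congr (_ * _).
    rewrite -integralTB; [|by bounded_meas|by bounded_meas].
    by apply: eq_integralT => w; rewrite mulrBl.
  rewrite -g_dist exprMn exprVn -mulrA ler_wpM2l//.
  exact: kernel_sandwich_bound.
have gS_bound n x y : g n.+1 x y ^+ 2 <= C * a 0%N.
  rewrite gS exprMn exprVn -mulrA ler_wpM2l//.
  apply: (le_trans (kernel_sandwich_bound bK (bg n) KM x y)).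
  by rewrite g_norm ler_wpM2l//; exact: a_noninc.
pose B := Num.sqrt (C * a 0%N).
(* The uniform bounds hold from index 1 on, since they require a sandwiched form. *)
pose h n := g n.+1.
have hB n x y : `|h n x y| <= B by rewrite -sqrtr_sqr; apply: ler_wsqrtr;
  exact: gS_bound.
have h_cvg x y : cvgn (fun n => h n x y).
  apply/cauchy_cvgP/cauchy_exP => e e_gt0.
  (* Two of the three terms in [gS_dist] are at most [a (N + N).+1], and the middle one is at least
     [ell]. *)
  have [N aN] : exists N, C * (2 * (a (N + N).+1 - ell)) < e ^+ 2.
    have : (fun N => C * (2 * (a N - ell))) @ \oo --> C * (2 * (ell - ell)).
      apply: cvgM; first exact: cvg_cst.
      apply: cvgM; first exact: cvg_cst.
      apply: cvgB; last exact: cvg_cst.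
      exact: a_cvg.
    rewrite subrr !mulr0 => /cvgr_lt/(_ (e ^+ 2));
      rewrite exprn_gt0// => /(_ isT).
    move=> [N _ HN]; exists N; apply: HN => /=.
    by rewrite -addnS leq_addr.
  exists (h N x y); exists N => // n /= Nn.
  rewrite /ball/= -(ltr_pXn2r (ltn0Sn 1)) ?nnegrE ?(ltW e_gt0)//.
  rewrite -normrX ger0_norm ?sqr_ge0//.
  apply: (le_lt_trans (gS_dist _ _ _ _)); apply: le_lt_trans aN.
  apply: ler_wpM2l => //.
  have h1 : a (n + n).+1 <= a (N + N).+1 by apply: a_noninc;
    rewrite ltnS leq_add.
  by have := ell_le (N + n).+1; lra.
pose G x y := limn (fun n => h n x y).
have hG x y : (fun n => h n x y) @ \oo --> G x y by exact: h_cvg.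
have bh n : bounded_measurable2 (h n) by exact: bg.
have mh n : measurable_fun setT (fun p : X * X =>
  h n p.1 p.2) by case: (bg n.+1).
have GB x y : `|G x y| <= B.
  have cG : (fun n => `|h n x y|) @ \oo --> `|G x y| by apply: cvg_norm;
    exact: hG.
  rewrite -(cvg_lim (@Rhausdorff R) cG).
  apply: limr_le; first by apply/cvg_ex; exists `|G x y|.
  by near=> n.
have bG : bounded_measurable2 G.
  split; last by exists B => p.
  by apply: (measurable_fun_cvg mh) => p _.
have G_eq x y : G x y = rho^-1 * kernel_app m (Kp 1%N) (G ^~ y) x.
  have [mK1 [M1 K1M]] := bKp 1%N.
  have : (fun n => h n.+1 x y) @ \oo --> rho^-1 * kernel_app m (Kp 1%N) (G ^~ y) x.
    under eq_fun do rewrite /h gS2.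
    apply: cvgM; [exact: cvg_cst|];
      apply: (@bounded_cvg_integralT _ _ _ _ _ _ (M1 * B)).
    - move=> n; have b1 := bg n.+1; have b2 := bKp 1%N.
      suff [] : bounded_measurable (fun z => Kp 1%N x z * g n.+1 z y) by [].
      by bounded_meas.
    - move=> n z; rewrite normrM ler_pM//; first exact: (K1M (x, z)).
      exact: (hB n).
    - by move=> z; apply: cvgM; [exact: cvg_cst|]; exact: hG.
  move/cvg_lim => <- //; apply/esym/cvg_lim => //.
  by have := hG x y; rewrite -(cvg_shiftS (fun n => h n x y)).
have G_norm : 1 <= kernel_norm2 m G.
  have cG : (fun n => kernel_norm2 m (h n)) @ \oo --> kernel_norm2 m G.
    have E L : bounded_measurable2 L -> kernel_norm2 m L =
        \int[(m \x m)%E]_p (L p.1 p.2 ^+ 2).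
      move=> bL; apply: (prod_probability_integral m (K := fun x y =>
        L x y ^+ 2)).
      by rewrite /bounded_measurable2; bounded_meas.
    rewrite (E _ bG); under eq_fun do rewrite (E _ (bh _)).
    apply: (@bounded_cvg_integralT _ _ _ _ _ _ (B ^+ 2)).
    - by move=> n; exact: measurable_funX.
    - by move=> n p; rewrite normrX lerXn2r ?nnegrE// sqrtr_ge0.
    - by move=> p; under eq_fun do rewrite expr2; rewrite expr2; apply: cvgM;
      exact: hG.
  rewrite -(cvg_lim (@Rhausdorff R) cG); apply: limr_ge.
    by apply/cvg_ex; exists (kernel_norm2 m G).
  by near=> n; rewrite /h g_norm; exact: a_ge1.
have [y Gy] : exists y, \int[m]_x (G x y ^+ 2) != 0.
  apply: contrapT => /forallNP Gy0.
  suff G0 : kernel_norm2 m G = 0 by move: G_norm; rewrite G0 ler10.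
  rewrite /kernel_norm2 integralT_swap; last first.
    by rewrite /bounded_measurable2; bounded_meas.
  rewrite -[RHS](integralT_cst m); apply: eq_integralT => y.
  by apply/eqP/negPn/negP; exact: Gy0.
pose f := G ^~ y.
have bf : bounded_measurable f by rewrite /f; bounded_meas.
have f_eq x : kernel_app m K (kernel_app m K f) x = rho * f x.
  rewrite -kernel_app_comp// [f x]G_eq mulrA divff ?gt_eqF// mul1r.
  by rewrite -KpS Kp0.
pose r := Num.sqrt rho.
have r_gt0 : 0 < r by rewrite sqrtr_gt0.
have rE : r ^+ 2 = rho by rewrite sqr_sqrtr// ltW.
have bKf := bounded_measurable_app m bK bf.
(* [K e - r e] equals [K (K f) - rho f], which is 0. So [e] is an eigenfunction for [r], unless it
   vanishes almost everywhere, and then [K f = - r f]. *)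
pose e x := kernel_app m K f x + r * f x.
have be : bounded_measurable e by rewrite /e; bounded_meas.
have [e0|e_neq0] := eqVneq (\int[m]_x (e x ^+ 2)) 0; last first.
  exists r, e; split; [by rewrite gt_eqF|exact: be|exact: e_neq0|].
  apply: aeW => x.
  have -> : kernel_app m K e x =
      kernel_app m K (kernel_app m K f) x + r * kernel_app m K f x.
    rewrite -[r * _]integralTZl; last by bounded_meas.
    rewrite -integralTD; [|by bounded_meas|by bounded_meas].
    by apply: eq_integralT => z; rewrite /e; ring.
  by rewrite f_eq -rE /e; ring.
exists (- r), f; split; [by rewrite oppr_eq0 gt_eqF|exact: bf|exact: Gy|].
have /integralT_eq0_ae : bounded_measurable (fun x => e x ^+ 2) by bounded_meas.
move=> /(_ m (fun x => sqr_ge0 _) e0); apply: filterS => x /eqP.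
by rewrite sqrf_eq0 /e addr_eq0 => /eqP ->; rewrite mulNr.
Unshelve. all: by end_near. Qed.

End SpectralTheorem.

(** By symmetry, [r] times the integral of [f] is the inner product of [K 1 = 0] with [f]. *)
Lemma symmetric_kernel_eigenfunction_orthogonal {d} {X : measurableType d}
    {R : realType} (m : probability X R) (K : X -> X -> R) :
  bounded_measurable2 K -> (forall x y, K x y = K y x) ->
  kernel_norm2 m K != 0 -> {ae m, forall x, \int[m]_y K x y = 0} ->
  exists r f, [/\ r != 0, bounded_measurable f, \int[m]_x (f x ^+ 2) != 0,
    \int[m]_x f x = 0 & {ae m, forall x, kernel_app m K f x = r * f x}].
Proof.
move=> bK symK K_neq0 K1.
have [r [f [r0 bf f0 Kf]]] := symmetric_kernel_eigenfunction bK symK K_neq0.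
exists r, f; split=> //; apply: (mulfI r0); rewrite mulr0.
have b1 : bounded_measurable (fun _ : X =>
  1 : R) by exact: bounded_measurable_cst.
have bKf := bounded_measurable_app m bK bf.
have bK1 := bounded_measurable_app m bK b1.
transitivity (\int[m]_x (1 * kernel_app m K f x)).
  rewrite -integralTZl//; apply: ae_eq_integralT;
    [by bounded_meas|by bounded_meas|].
  by apply: filterS Kf => x ->; rewrite mul1r.
rewrite kernel_app_adjoint// -[RHS](integralT_cst m).
apply: ae_eq_integralT; [by bounded_meas|by bounded_meas|].
apply: filterS K1 => x K1x; rewrite /kernel_app.
have -> : \int[m]_y (K x y * 1) = \int[m]_y K x y.
  by apply: eq_integralT => y; rewrite mulr1.
by rewrite K1x mul0r.
Qed.

(** * Zero-one valued kernels with constant star kernel *)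

Section StarKernel.
Context {d} {X : measurableType d} {R : realType} (m : probability X R).
Variable w : X -> X -> R.

Definition degree (x : X) : R := \int[m]_y w x y.

Definition codegree (x y : X) : R := \int[m]_z (w x z * w y z).

Hypothesis bw : bounded_measurable2 w.

Lemma bounded_measurable_degree : bounded_measurable degree.
Proof. by rewrite /degree; bounded_meas. Qed.

Lemma bounded_measurable2_codegree : bounded_measurable2 codegree.
Proof. by rewrite /bounded_measurable2 /codegree; bounded_meas. Qed.

Hypothesis w_sym : forall x y, w x y = w y x.
Hypothesis w01 : forall x y, 0 <= w x y <= 1.

Let w_ge0 x y : 0 <= w x y. Proof. by have /andP[] := w01 x y. Qed.
Let w_le1 x y : w x y <= 1. Proof. by have /andP[] := w01 x y. Qed.

Lemma degree_ge0 x : 0 <= degree x.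
Proof. exact: integralT_ge0. Qed.

Lemma codegree_ge0 x y : 0 <= codegree x y.
Proof. by apply: integralT_ge0 => z; rewrite mulr_ge0. Qed.

Lemma codegree_le_degree x y : codegree x y <= degree x.
Proof.
apply: le_integralT; [by bounded_meas|by bounded_meas|] => z.
by rewrite ler_piMr.
Qed.

(** Let [B] be the zero set of the degree. Integrating [w x y] first over [x], then over [y] in [B],
    gives the integral of the degree over [B], that is 0. *)
Lemma ae_neighbour_degree_neq0 :
  {ae m, forall x, {ae m, forall y, degree y = 0 -> w x y = 0}}.
Proof.
have bdeg := bounded_measurable_degree.
pose B := degree @^-1` [set 0].
have mB : measurable B.
  case: bdeg => mdeg _; rewrite -[B]setTI.
  by apply: mdeg => //; exact: measurable_set1.
have bB := bounded_measurable_indic (R := R) mB.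
have bwB : bounded_measurable2 (fun x y => w x y * \1_B y : R).
  by rewrite /bounded_measurable2; bounded_meas.
have wB_ge0 x y : 0 <= w x y * \1_B y by rewrite mulr_ge0.
have I0 : \int[m]_x \int[m]_y (w x y * \1_B y) = 0.
  rewrite integralT_swap// -[RHS](integralT_cst m); apply: eq_integralT => y.
  rewrite integralTZr; last by bounded_meas.
  have -> : \int[m]_x w x y = degree y by apply: eq_integralT => x;
    exact: w_sym.
  rewrite indicE; case: (boolP (y \in B)); rewrite ?mulr0//.
  by rewrite inE => ->; rewrite mul0r.
have := integral2_eq0_ae bwB wB_ge0 I0.
apply: filterS => x; apply: filterS => y + yB.
by rewrite indicE mem_set// mulr1.
Qed.

Lemma star_kernel_constant (c : R) : 0 < c ->
  {ae m, forall x, {ae m, forall y, w x y * (1 - w x y) * degree x ^+ 2 = 0}} ->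
  {ae m, forall x, {ae m, forall y,
    w x y * (degree x + degree y) + codegree x y = c}} ->
  {ae m, forall x, {ae m, forall y, w x y = 1}}.
Proof.
move=> c_gt0; apply: filterS3 ae_neighbour_degree_neq0 => x xdeg xw xc.
have bwx : bounded_measurable (w x) by bounded_meas.
have xdeg0 : degree x = 0 -> {ae m, forall y, w x y = 0}.
  by move=> d0; apply: integralT_eq0_ae.
have w01E y : degree x != 0 -> w x y * (1 - w x y) * degree x ^+ 2 = 0 ->
    w x y = 0 \/ w x y = 1.
  move=> dx /eqP; rewrite !mulf_eq0 (negbTE dx) !orbF subr_eq0.
  by move=> /orP[/eqP|/eqP/esym]; [left|right].
(* In degree 0, both [w x y] and the codegree vanish for almost every [y], contradicting [0 < c]. *)
have [dx|dx] := eqVneq (degree x) 0.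
  apply: filterS2 (xdeg0 dx) xc => y wxy0.
  have := codegree_le_degree x y; have := codegree_ge0 x y.
  by rewrite wxy0 dx => *; lra.
(* If [c <= degree x], a point [z] with [w x z = 1] has degree 0, hence [w x z = 0] by [xdeg]. So
   [w x] would vanish almost everywhere, against [dx]. *)
have [c_le|c_gt] := leP c (degree x).
  exfalso; move/eqP: (dx); apply.
  rewrite -[RHS](integralT_cst m); apply: ae_eq_integralT => //.
    exact: bounded_measurable_cst.
  apply: filterS3 xdeg xw xc => z zdeg /(w01E z dx) [//|w1] zc.
  apply: zdeg; move: zc; rewrite w1.
  by have := codegree_ge0 x z; have := degree_ge0 z; lra.
(* Where [w x y = 0], the codegree would be [c], which exceeds [degree x]. *)
apply: filterS2 xw xc => y /(w01E y dx)[w0|//].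
by rewrite w0; have := codegree_le_degree x y; lra.
Qed.

End StarKernel.

(** * Degenerate Gaussian limits *)

Lemma ae_eq_measure {d} {T : measurableType d} {R : realType}
    (mu : {measure set T -> \bar R}) (A B : set T) :
  measurable A -> measurable B -> {ae mu, forall x, A x <-> B x} -> mu A = mu B.
Proof.
move=> mA mB AB; rewrite -[A]setIT -[B]setIT -!integral_indic//.
apply: ae_eq_integral => //.
- by apply/measurable_EFinP; exact: measurable_indic.
- by apply/measurable_EFinP; exact: measurable_indic.
apply: filterS AB => x AB _; rewrite !indicE.
have [xA|xA] := boolP (x \in A).
  by rewrite mem_set//; apply/AB; rewrite inE in xA.
case: (boolP (x \in B)) => // /set_mem/AB/mem_set.
by rewrite (negbTE xA).
Qed.

Lemma probability_setC_eq0 {d} {T : measurableType d} {R : realType}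
    (P : probability T R) (A : set T) :
  measurable A -> P A = 1%E -> P (~` A) = 0%E.
Proof. by move=> mA PA; rewrite probability_setC// PA subee. Qed.

Lemma measurable_sublevel {R : realType} (phi : R -> R) (x : R) :
  measurable_fun setT phi -> measurable [set y | phi y <= x].
Proof.
move=> mphi; rewrite (_ : mkset _ = phi @^-1` `]-oo, x]%classic).
  by rewrite -[_ @^-1` _]setTI; apply: mphi.
by apply/seteqP; split => y /=; rewrite in_itv.
Qed.

Lemma exists_invS_lt {R : realType} (e : R) : 0 < e ->
  exists N : nat, N.+1%:R^-1 < e.
Proof.
move=> e_gt0.
by have [N _ /(_ N (leqnn N)) Ne] := near_infty_natSinv_lt (PosNum e_gt0);
  exists N.
Qed.

(** * A variable determined by variables independent of it *)

Section Independence.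
Context {d} {T : measurableType d} {R : realType} (P : probability T R).
Variables (J : eqType) (X : J -> T -> R).
Hypothesis mX : forall i, measurable_fun setT (X i).
Hypothesis X_indep : mutually_independent P setT X.
Variable i0 : J.

(** A pi-system that generates the sigma-algebra of all the variables other than [X i0]. *)
Definition cylinders_off : set (set T) :=
  [set E | exists s : seq J, exists A : J -> set R,
    [/\ uniq s, i0 \notin s, forall i, measurable (A i) &
        E = \bigcap_(i in [set` s]) (X i @^-1` A i)]].

Lemma cylinders_off_measurable : cylinders_off `<=` measurable.
Proof.
move=> _ [s [A [_ _ mA ->]]]; apply: fin_bigcap_measurable => // i _.
by rewrite -[_ @^-1` _]setTI; apply: mX.
Qed.

Lemma cylinders_offT : cylinders_off setT.
Proof.
exists [::], (fun=> setT); split => //.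
by apply/seteqP; split => // w _ i.
Qed.

Lemma cylinders_offI : setI_closed cylinders_off.
Proof.
move=> _ _ [s [A [us i0s mA ->]]] [s' [A' [us' i0s' mA' ->]]].
exists (undup (s ++ s')), (fun i => (if i \in s then A i else setT) `&`
  (if i \in s' then A' i else setT)); split.
- exact: undup_uniq.
- by rewrite mem_undup mem_cat negb_or i0s.
- by move=> i; apply: measurableI; case: ifP.
- apply/seteqP; split => [w [ws ws'] i _|w wss'].
    by split; case: ifPn => // ii; [exact: ws|exact: ws'].
  split => i /= ii; have := wss' i; rewrite /= mem_undup mem_cat ii ?orbT.
    by move=> /(_ isT)[].
  by move=> /(_ isT)[].
Qed.

(** As functions of [E], both sides are finite measures, a restriction and a multiple of [P]. They
    agree on the pi-system, hence on the sigma-algebra it generates. *)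
Lemma cylinders_off_indep (C : set R) (E : set T) : measurable C ->
  <<s cylinders_off >> E -> P (E `&` X i0 @^-1` C) = (P (X i0 @^-1` C) * P E)%E.
Proof.
move=> mC sE; set B := X i0 @^-1` C.
have mB : measurable B by rewrite -[B]setTI; apply: mX.
have p0 : 0 <= fine (P B) by rewrite fine_ge0.
pose p := NngNum p0.
have pE : p%:num%:E = P B by rewrite /= fineK// fin_num_measure.
rewrite -pE.
apply: (@g_sigma_algebra_measure_unique _ R T cylinders_off
  cylinders_off_measurable (fun=> setT) (fun=> cylinders_offT) _
  (mrestr P mB) (mscale p P) cylinders_offI _ _ E sE).
- by apply/seteqP; split => // w _; exists 0%N.
- move=> _ [s [A [us i0s mA ->]]].
  change (P (\bigcap_(i in [set` s]) (X i @^-1` A i) `&` B) =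
    (p%:num%:E * P (\bigcap_(i in [set` s]) (X i @^-1` A i)))%E).
  rewrite pE (X_indep us)//.
  (* The event [B] becomes one more factor, at the index [i0] absent from [s], so that mutual
     independence applies to the enlarged list. *)
  have -> : \bigcap_(i in [set` s]) X i @^-1` A i `&` B =
      \bigcap_(i in [set` i0 :: s]) X i @^-1` (if i == i0 then C else A i).
    apply/seteqP; split => [w [ws wB] i /=|w ws].
      rewrite inE => /predU1P[->|ii]; first by rewrite eqxx.
      by case: eqP => [->//|_]; exact: ws.
    split => [i /= ii|].
      have := ws i; rewrite /= inE ii orbT => /(_ isT).
      by case: eqP ii i0s => [->->|].
    by have := ws i0; rewrite /= inE eqxx => /(_ isT).
  rewrite X_indep//=; first last.
  - by move=> i; case: ifP.
  - by rewrite i0s.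
  rewrite big_cons eqxx; congr (_ * _)%E.
  rewrite big_seq [RHS]big_seq; apply: eq_bigr => i ii.
  by case: eqP ii i0s => [->->|].
- move=> _; rewrite /= /mrestr (le_lt_trans (probability_le1 _ _)) ?ltry//.
  exact: measurableI.
Qed.

Lemma measurable_fun_cylinders_off i : i != i0 ->
  measurable_fun setT (X i : g_sigma_algebraType cylinders_off -> R).
Proof.
move=> ii0 _ C mC; rewrite setTI; apply: sub_sigma_algebra.
exists [:: i], (fun=> C); split => //; first by rewrite inE eq_sym.
apply/seteqP; split => [w wC j /=|w /(_ i)/=]; first by rewrite inE => /eqP ->.
by rewrite inE eqxx => /(_ isT).
Qed.

(** The event [phi (X i0) <= x] coincides almost surely with an event of the sigma-algebra of the
    other variables, so it is independent of itself and its probability [q] satisfies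
    [q = q * q]. *)
Lemma independent_limit_zero_one (S : nat -> T -> R) (phi : R -> R) (x : R) :
  (forall n, measurable_fun setT (S n : g_sigma_algebraType cylinders_off ->
    R)) ->
  measurable_fun setT phi ->
  {ae P, forall w, (fun n => S n w) @ \oo --> phi (X i0 w)} ->
  P (X i0 @^-1` [set y | phi y <= x]) = 0%E \/
  P (X i0 @^-1` [set y | phi y <= x]) = 1%E.
Proof.
move=> mS mphi S_cvg; set C := [set y | phi y <= x]; set B := X i0 @^-1` C.
have mC : measurable C by exact: measurable_sublevel.
have mB : measurable B by rewrite -[B]setTI; apply: mX.
(* [E] says that the limit superior of [S n] is at most [x], in countable operations: for each [k],
   eventually [S n <= x + 1 / (k + 1)]. *)
pose E := \bigcap_k \bigcup_N \bigcap_(n in [set n | (N <= n)%N])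
  [set w | S n w <= x + k.+1%:R^-1].
have sE : <<s cylinders_off >> E.
  apply: (@bigcap_measurable _ (g_sigma_algebraType cylinders_off)) => // k _.
  apply: bigcup_measurable => N _; apply: bigcap_measurable => //.
    by exists N => /=.
  move=> n _.
  have -> : [set w | S n w <= x + k.+1%:R^-1] =
    S n @^-1` `]-oo, x + k.+1%:R^-1]%classic.
    by apply/seteqP; split => y /=; rewrite in_itv.
  by rewrite -[_ @^-1` _]setTI; apply: mS.
have mE : measurable E.
  exact: (smallest_sub (@sigma_algebra_measurable _ T) cylinders_off_measurable).
have EB : {ae P, forall w, E w <-> B w}.
  apply: filterS S_cvg => w Sw; split => [Ew|Bw k _].
    rewrite /B/C/=; apply/ler_addgt0Pr => e e_gt0.
    have [k ke] := exists_invS_lt e_gt0.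
    have [N _ HN] := Ew k I.
    rewrite -(cvg_lim (@Rhausdorff R) Sw).
    apply: limr_le; first by apply/cvg_ex; exists (phi (X i0 w)).
    exists N => // n /= Nn; apply: le_trans (HN n Nn) _.
    by rewrite lerD2l ltW.
  have : phi (X i0 w) < x + k.+1%:R^-1.
    by rewrite (le_lt_trans Bw)// ltrDl invr_gt0.
  move/cvgr_lt : Sw => /[apply] -[N _ HN].
  by exists N => // n /= Nn; apply/ltW/HN.
have PEB : P E = P B.
  exact: ae_eq_measure.
have PEIB : P (E `&` B) = P B.
  apply: ae_eq_measure => //; first exact: measurableI.
  by apply: filterS EB => w EBw; split => [[]//|Bw]; split => //; exact/EBw.
have := cylinders_off_indep mC sE; rewrite -/B PEIB PEB.
rewrite -[P B]fineK ?fin_num_measure// -EFinM => -[].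
set q := fine _ => qq.
have : q * (1 - q) = 0 by rewrite mulrBr mulr1 -qq subrr.
move=> /eqP; rewrite mulf_eq0 subr_eq0 => /orP[/eqP ->|/eqP <-];
  [by left|by right].
Qed.

End Independence.

(** The density is positive everywhere, so a zero integral would make the interval Lebesgue null. *)
Lemma normal_prob_itv_gt0 {R : realType} (a b : R) : a < b ->
  (0 < @normal_prob R 0 1 `[a, b])%E.
Proof.
move=> ab; rewrite lt_neqAle measure_ge0 andbT; apply/negP => /eqP/esym N0.
have pdf_gt0 x : 0 < @normal_pdf R 0 1 x.
  rewrite normal_pdfE ?oner_neq0// mulr_gt0 ?normal_peak_gt0 ?oner_neq0//.
  exact: expR_gt0.
have mpdf : measurable_fun `[a, b] (EFin \o @normal_pdf R 0 1).
  by apply/measurable_EFinP; apply: measurable_funTS;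
    exact: measurable_normal_pdf.
have /(ae_eq_integral_abs lebesgue_measure (measurable_itv _) mpdf)/= :
    (\int[lebesgue_measure]_(x in `[a, b]) `|(EFin \o @normal_pdf R 0 1) x| =
      0)%E.
  rewrite -[RHS]N0; apply: eq_integral => x _ /=.
  by rewrite gtr0_norm.
move=> [A [mA A0 sA]].
have : (lebesgue_measure (`[a, b]%classic : set R) <= lebesgue_measure A)%E.
  apply: le_measure; rewrite ?inE//.
  move=> x xab; apply: sA => /= /(_ xab)[] /eqP; rewrite gt_eqF//.
by rewrite A0 lebesgue_measure_itv/= lte_fin ab lee_fin leNgt subr_gt0 ab.
Qed.

Lemma normal_prob_nontrivial {R : realType} (C : set R) (a b a' b' : R) :
  measurable C -> a < b -> `[a, b]%classic `<=` C ->
  a' < b' -> `[a', b']%classic `<=` ~` C ->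
  @normal_prob R 0 1 C <> 0%E /\ @normal_prob R 0 1 C <> 1%E.
Proof.
move=> mC ab abC a'b' a'b'C; split => C01.
  have := normal_prob_itv_gt0 ab; rewrite lt_neqAle => /andP[/eqP + _]; apply.
  by apply/esym/eqP; rewrite -measure_le0 -C01 le_measure ?inE.
have := normal_prob_itv_gt0 a'b'; rewrite lt_neqAle => /andP[/eqP + _]; apply.
apply/esym/eqP; rewrite -measure_le0.
rewrite -[leRHS](probability_setC_eq0 (P := normal_prob 0 1) mC C01).
by rewrite le_measure ?inE//; exact: measurableC.
Qed.

Lemma standard_gaussian_nontrivial {d} {T : measurableType d} {R : realType}
    (P : probability T R) (X : {RV P >-> R}) (C : set R) (a b a' b' : R) :
  standard_gaussian X ->
  measurable C -> a < b -> `[a, b]%classic `<=` C ->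
  a' < b' -> `[a', b']%classic `<=` ~` C ->
  ~ (P (X @^-1` C) = 0%E \/ P (X @^-1` C) = 1%E).
Proof.
move=> gX mC ab abC a'b' a'b'C.
have [N0 N1] := normal_prob_nontrivial mC ab abC a'b' a'b'C.
by have /= := gX C mC; rewrite /distribution/= /pushforward => -> [].
Qed.

Lemma gaussian_limit_degenerate {d} {T : measurableType d} {R : realType}
    (P : probability T R) (Z : {RV P >-> R}) (G : nat -> {RV P >-> R})
    (s : R) (lam : nat -> R) (c : R) :
  gaussian_sample Z G ->
  {ae P, forall w, (fun n =>
    s * Z w + \sum_(0 <= i < n) lam i * (G i w ^+ 2 - 1))
    @ \oo --> c} ->
  s = 0 /\ forall i, lam i = 0.
Proof.
move=> [gZ gG indep] cvgS.
pose X (z : option nat) : T -> R := if z is Some i then G i : T -> R else Z.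
have mX z : measurable_fun setT (X z) by case: z => [i|] /=;
  exact: measurable_funP.
have mterm i0 (j : nat) : Some j != i0 -> measurable_fun setT
    ((fun w => lam j * (G j w ^+ 2 - 1)) : g_sigma_algebraType (cylinders_off X i0) -> R).
  move=> ji0; apply: measurable_funM; first exact: measurable_cst.
  apply: measurable_funB; last exact: measurable_cst.
  by apply: measurable_funX;
    exact: (measurable_fun_cylinders_off (i := Some j)).
split.
  apply: contrapT => /eqP s0.
  pose S n w := \sum_(0 <= i < n) lam i * (G i w ^+ 2 - 1).
  have mS n : measurable_fun setT (S n : g_sigma_algebraType (cylinders_off X None) -> R).
    by apply: measurable_sum => j; exact: mterm.
  have mf : measurable_fun setT (fun y : R => c - s * y).
    by apply: measurable_funB => //; exact: measurable_funM.
  have Scvg : {ae P, forall w, (fun n => S n w) @ \oo --> c - s * X None w}.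
    apply: filterS cvgS => w cw.
    have -> : (fun n => S n w) = (fun n => (s * Z w + S n w) - s * Z w).
      by apply/funext => n; ring.
    by apply: cvgB; [exact: cw|exact: cvg_cst].
  (* The threshold [c] gives the event [0 <= s * Z]; it and its complement both contain a
     non-trivial interval of values. *)
  have := independent_limit_zero_one mX indep c mS mf Scvg.
  have [s_gt0|s_lt0|/eqP] := ltrgt0P s; last by rewrite (negbTE s0).
    apply: (standard_gaussian_nontrivial (a := 0) (b := 1) (a' := -2) (b' := -1)) => //.
    - exact: measurable_sublevel.
    - move=> y /=; rewrite in_itv/= => /andP[y0 y1].
      by have := mulr_ge0 (ltW s_gt0) y0; lra.
    - lra.
    - move=> y /=; rewrite in_itv/= => /andP[y0 y1] sy.
      have : s * (- y) > 0 by rewrite mulr_gt0//; lra.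
      lra.
  apply: (standard_gaussian_nontrivial (a := -2) (b := -1) (a' := 1) (b' := 2)) => //.
  - exact: measurable_sublevel.
  - lra.
  - move=> y /=; rewrite in_itv/= => /andP[y0 y1].
    have : (- s) * (- y) > 0 by rewrite mulr_gt0//; lra.
    lra.
  - lra.
  - move=> y /=; rewrite in_itv/= => /andP[y0 y1] sy.
    have : (- s) * y > 0 by rewrite mulr_gt0//; lra.
    lra.
move=> j; apply: contrapT => /eqP lj0.
pose S n w := s * Z w + \sum_(0 <= i < n | i != j) lam i * (G i w ^+ 2 - 1).
have mS n : measurable_fun setT (S n : g_sigma_algebraType (cylinders_off X (Some j)) -> R).
  apply: measurable_funD.
    apply: measurable_funM; first exact: measurable_cst.
    exact: (measurable_fun_cylinders_off (i := None)).
  rewrite [X in measurable_fun _ X](_ : _ = fun w => \sum_(0 <= i < n)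
      (if i != j then lam i * (G i w ^+ 2 - 1) else 0)); last first.
    by apply/funext => w; rewrite big_mkcond.
  apply: measurable_sum => i; case: (boolP (i != j)) => ij;
    last exact: measurable_cst.
  exact: mterm.
pose phi (y : R) := c - lam j * (y ^+ 2 - 1).
have mf : measurable_fun setT phi.
  apply: measurable_funB => //; apply: measurable_funM => //.
  by apply: measurable_funB.
have Scvg : {ae P, forall w, (fun n => S n w) @ \oo --> phi (X (Some j) w)}.
  apply: filterS cvgS => w cw.
  have : (fun n => (s * Z w + \sum_(0 <= i < n) lam i * (G i w ^+ 2 - 1))
      - lam j * (G j w ^+ 2 - 1)) @ \oo --> c - lam j * (G j w ^+ 2 - 1).
    by apply: cvgB; [exact: cw|exact: cvg_cst].
  (* The term of index [j] is present in the partial sum only once [n > j]. *)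
  apply: cvg_trans; apply: near_eq_cvg; exists j.+1 => // n /= jn.
  rewrite /S (bigD1_seq j) ?iota_uniq ?mem_index_iota//=.
  by ring.
(* The event is now [0 <= lam j * (y ^+ 2 - 1)], whose boundary is at [|y| = 1]. *)
have := independent_limit_zero_one mX indep c mS mf Scvg.
have [l_gt0|l_lt0|/eqP] := ltrgt0P (lam j); last by rewrite (negbTE lj0).
  apply: (standard_gaussian_nontrivial (a := 1) (b := 2) (a' := 0) (b' := 1/2)) => //.
  - exact: measurable_sublevel.
  - lra.
  - move=> y /=; rewrite in_itv/= => /andP[y0 y1].
    have : 0 <= lam j * (y ^+ 2 - 1) by rewrite mulr_ge0//; nra.
    by rewrite /phi; lra.
  - move=> y /=; rewrite in_itv/= => /andP[y0 y1] sy.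
    have : 0 < lam j * (1 - y ^+ 2) by rewrite mulr_gt0//; nra.
    by move: sy; rewrite /phi; lra.
apply: (standard_gaussian_nontrivial (a := 0) (b := 1) (a' := 2) (b' := 3)) => //.
- exact: measurable_sublevel.
- move=> y /=; rewrite in_itv/= => /andP[y0 y1].
  have : 0 <= (- lam j) * (1 - y ^+ 2) by rewrite mulr_ge0//; nra.
  by rewrite /phi; lra.
- lra.
- move=> y /=; rewrite in_itv/= => /andP[y0 y1] sy.
  have : 0 < (- lam j) * (y ^+ 2 - 1) by rewrite mulr_gt0//; nra.
  by move: sy; rewrite /phi; lra.
Qed.

(** * Degenerate limits in law *)

Section LawUniqueness.
Context {R : realType}.
Implicit Types (mu nu : probability R R) (c x : R).

(** The windows [V n] shrink to [x], so their measures tend to 0; they bound the increments of the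
    distribution function near [x]. *)
Lemma cdf_continuous_at mu x : mu [set x] = 0%E ->
  {for x, continuous (fun y : R => mu `]-oo, y]%classic)}.
Proof.
move=> mux0; rewrite /prop_for /continuous_at.
have fin (A : set R) : measurable A -> mu A = (fine (mu A))%:E.
  by move=> mA; rewrite fineK// fin_num_measure.
rewrite [X in _ --> X]fin; last exact: measurable_itv.
apply: cvg_EFin; first by near=> y; rewrite fin_num_measure.
apply/cvgrPdist_lt => e e_gt0.
pose V n : set R := `]x - n.+1%:R^-1, x + n.+1%:R^-1]%classic.
have mV n : measurable (V n) by exact: measurable_itv.
have capV : \bigcap_n V n = [set x].
  apply/seteqP; split => [y Vy /=|_ -> n _ /=].
    case: (ltgtP y x) => // yx;
      have [N Nr] := exists_invS_lt (etrans (subr_gt0 _ _) yx);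
      move: Nr (Vy N I); rewrite /V/= in_itv/=;
        set q := _^-1 => Nr /andP[y1 y2]; lra.
  rewrite /V/= in_itv/= ltrBlDr ltrDl lerDl invr_gt0 ltr0n/=.
  by rewrite invr_ge0 ler0n.
have : mu \o V @ \oo --> mu (\bigcap_n V n).
  apply: nonincreasing_cvg_mu => //.
  - by rewrite (le_lt_trans (probability_le1 _ _)) ?ltry.
  - by rewrite capV; exact: measurable_set1.
  - move=> i j ij; apply/subsetPset => y;
    rewrite /V/= !in_itv/= => /andP[y1 y2].
    have : (j.+1%:R^-1 : R) <= i.+1%:R^-1 by rewrite lef_pV2 ?posrE// ler_nat.
    by move: y1 y2; set p := _^-1; set q := _^-1 => *; apply/andP; split; lra.
rewrite capV mux0 => /fine_cvgP[_]/cvgrPdist_lt/(_ e e_gt0)[N _ /(_ N (leqnn N))].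
rewrite /= sub0r normrN ger0_norm ?fine_ge0// => Ve.
have bound (y z : R) : x - N.+1%:R^-1 < y -> y <= z -> z <= x + N.+1%:R^-1 ->
    `|fine (mu `]-oo, z]%classic) - fine (mu `]-oo, y]%classic)| <= fine (mu (V N)).
  move=> xy yz zx.
  have -> : fine (mu `]-oo, z]%classic) - fine (mu `]-oo, y]%classic) =
    fine (mu `]y, z]%classic).
    have -> : `]-oo, z]%classic =
      `]-oo, y]%classic `|` `]y, z]%classic :> set R.
      apply/seteqP; split => w /=; rewrite !in_itv/=.
        by move=> wz; case: (leP w y); [left|right].
      by move=> [wy|/andP[]//]; exact: le_trans yz.
    rewrite measureU//; last first.
      apply/seteqP; split => w //=; rewrite !in_itv/= => -[wy /andP[yw _]].
      by move: yw; rewrite ltNge wy.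
    by rewrite fineD ?fin_num_measure//; ring.
  rewrite ger0_norm ?fine_ge0// fine_le ?fin_num_measure// le_measure ?inE//.
  move=> w; rewrite /V/= !in_itv/= => /andP[y1 y2]; apply/andP; split.
    exact: lt_trans y1.
  exact: le_trans zx.
have N0 : 0 < N.+1%:R^-1 :> R by rewrite invr_gt0.
near=> y.
have : `|x - y| < N.+1%:R^-1.
  by near: y; exists N.+1%:R^-1.
rewrite ltr_norml => /andP[h1 h2]; apply: le_lt_trans Ve.
move: (N0) bound h1 h2; set q := _^-1 => q0 bound h1 h2.
by case: (leP x y) => xy; [rewrite distrC|]; apply: bound; lra.
Unshelve. all: by end_near. Qed.

Lemma cdf_dirac nu c x : nu [set c] = 1%E ->
  nu `]-oo, x]%classic = (if (c <= x)%R then 1 else 0)%E.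
Proof.
move=> nuc; case: (leP c x) => cx.
  apply/eqP; rewrite eq_le probability_le1//= -nuc le_measure ?inE//.
  by move=> _ ->; rewrite /= in_itv.
apply/eqP; rewrite -measure_le0.
rewrite -[leRHS](probability_setC_eq0 (measurable_set1 c) nuc).
rewrite le_measure ?inE//; first exact: measurableC.
by move=> y /=; rewrite in_itv/= => yx yc; move: cx; rewrite -yc ltNge yx.
Qed.

Lemma cdf_dirac_continuous nu c x : nu [set c] = 1%E -> x != c ->
  {for x, continuous (fun y : R => nu `]-oo, y]%classic)}.
Proof.
move=> nuc xc; apply: cdf_continuous_at.
apply/eqP; rewrite -measure_le0.
rewrite -[leRHS](probability_setC_eq0 (measurable_set1 c) nuc).
rewrite le_measure ?inE//; first exact: measurableC.
by move=> _ ->; apply/eqP.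
Qed.

(** The atoms are countably many, whereas the interval has positive Lebesgue measure. *)
Lemma exists_non_atom {d} {T : measurableType d} (P : probability T R)
    (L : {RV P >-> R}) (a b : R) : a < b ->
  exists2 x, a < x < b & distribution P L [set x] = 0%E.
Proof.
move=> ab; apply: contrapT => noatom.
have : countable (`]a, b[%classic : set R).
  apply: sub_countable (pmf_gt0_countable L); apply: subset_card_le => x /=.
  rewrite in_itv/= => xab; rewrite lt_neqAle pmf_ge0 andbT eq_sym.
  apply/eqP => p0; apply: noatom; exists x => //.
  by rewrite -[LHS]fineK ?fin_num_measure//; congr (_%:E).
move/countable_lebesgue_measure0;
  rewrite lebesgue_measure_itv/= lte_fin ab => -[].
by move/eqP; rewrite subr_eq0 gt_eqF.
Qed.

(** The two limiting distribution functions agree at each [x != c] that is not an atom of [mu]. Such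
    points exist in every interval, so [mu] has no mass on either side of [c]. *)
Lemma cvg_in_law_dirac {d d'} {T : measurableType d} {T' : measurableType d'}
    (P : probability T R) (X : nat -> T -> R) (P' : probability T' R)
    (L : {RV P' >-> R}) nu c :
  cvg_in_law P X (distribution P' L) -> cvg_in_law P X nu -> nu [set c] = 1%E ->
  distribution P' L [set c] = 1%E.
Proof.
move=> XL Xnu nuc; pose mu : probability R R := distribution P' L.
change (mu [set c] = 1%E).
have cdfE x : x != c -> mu [set x] = 0%E ->
    mu `]-oo, x]%classic = (if (c <= x)%R then 1 else 0)%E.
  move=> xc mux0; rewrite -(cdf_dirac x nuc).
  have c1 := XL x (cdf_continuous_at mux0).
  have c2 := Xnu x (cdf_dirac_continuous nuc xc).
  exact: cvg_unique c1 c2.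
have below y : y < c -> mu `]-oo, y]%classic = 0%E.
  move=> yc; have [x /andP[yx xc] mux0] := exists_non_atom L yc.
  apply/eqP; rewrite -measure_le0.
  have <- : mu `]-oo, x]%classic = 0%E by rewrite cdfE// ?lt_eqF// leNgt xc.
  by rewrite le_measure ?inE//; apply: subitvPr; exact: ltW.
have above y : c < y -> mu `]y, +oo[%classic = 0%E.
  move=> cy; have [x /andP[cx xy] mux0] := exists_non_atom L cy.
  apply/eqP; rewrite -measure_le0.
  have <- : mu (~` `]-oo, x]%classic) = 0%E.
    by apply: probability_setC_eq0; rewrite ?cdfE// ?gt_eqF// (ltW cx).
  rewrite le_measure ?inE//; first exact: measurableC.
  by move=> w /=; rewrite !in_itv/= andbT => yw; apply/negP;
    rewrite -ltNge (lt_trans xy).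
have : mu.-negligible (~` [set c]).
  apply: (@negligibleS _ _ _ mu
    (\bigcup_n (`]-oo, c - n.+1%:R^-1]%classic `|` `]c + n.+1%:R^-1, +oo[%classic))).
    move=> y /eqP/=; rewrite neq_lt => /orP[yc|cy].
      have [N Nr] := exists_invS_lt (etrans (subr_gt0 _ _) yc).
      by exists N => //; left; rewrite /= in_itv/=; move: Nr;
        set q := _^-1 => Nr; lra.
    have [N Nr] := exists_invS_lt (etrans (subr_gt0 _ _) cy).
    by exists N => //; right; rewrite /= in_itv/= andbT; move: Nr;
      set q := _^-1 => Nr; lra.
  apply: negligible_bigcup => n; apply: negligibleU.
    apply/negligibleP => //; apply: below.
    by rewrite ltrBlDr ltrDl invr_gt0.
  apply/negligibleP => //; apply: above.
  by rewrite ltrDl invr_gt0.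
move/negligibleP => /(_ (measurableC (measurable_set1 c))) mu0.
rewrite -[[set c]]setCK probability_setC//; last exact: measurableC.
by transitivity (1 - 0 : \bar R)%E; [congr (1 - _)%E|rewrite sube0].
Qed.

End LawUniqueness.

(** * Densities as iterated integrals over the uniform probability *)

Section UniformProbability.
Context {R : realType}.
Local Notation mu := (@lebesgue_measure R).
Local Notation m := (uniform_prob (@ltr01 R)).
Local Notation I01 := (`[0%R, 1%R]%classic : set R).

Lemma bounded_measurable_integrable01 (g : R -> R) : bounded_measurable g ->
  mu.-integrable I01 (EFin \o g).
Proof.
move=> [mg [M gM]].
have muI_fin : (mu I01 < +oo)%E.
  by rewrite lebesgue_measure_itv/= lte_fin ltr01 oppr0 adde0 ltry.
apply: measurable_bounded_integrable => //; first exact: measurable_funTS.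
exists M; split; first exact: num_real.
by move=> A MA x _; apply: le_trans (gM x) (ltW MA).
Qed.

Lemma Rintegral_uniform01 (g : R -> R) : bounded_measurable g ->
  \int[mu]_(x in I01) g x = \int[m]_x g x.
Proof.
move=> bg; have [mg [M gM]] := bg.
have ge0 (h : R -> R) : measurable_fun setT h -> (forall x, 0 <= h x) ->
    \int[mu]_(x in I01) h x = \int[m]_x h x.
  move=> mh h0; rewrite /Rintegral integral_uniform//;
    last exact/measurable_EFinP.
  by rewrite subr0 invr1 mul1e.
have M0 : 0 <= M := le_trans (normr_ge0 _) (gM 0).
have gM_ge0 x : 0 <= g x + M by have := gM x; rewrite ler_norml => /andP[]; lra.
(* The change of measure is applied to the non-negative function [g + M]. *)
have : \int[mu]_(x in I01) (g x + M) = \int[m]_x (g x + M).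
  by apply: ge0 => //; apply: measurable_funD.
rewrite integralTD//; last exact: bounded_measurable_cst.
have muI : (mu I01 = 1)%E
  by rewrite lebesgue_measure_itv/= lte_fin ltr01 oppr0 adde0.
have bM : bounded_measurable (fun _ : R => M) by exact: bounded_measurable_cst.
have int_g := bounded_measurable_integrable01 bg.
have int_M := bounded_measurable_integrable01 bM.
rewrite RintegralD// integralT_cst Rintegral_cst// -[fine _]/(fine (mu I01)) muI.
rewrite mulr1 => /eqP.
by rewrite (inj_eq (addIr _)) => /eqP.
Qed.

Lemma uniform_prob01E (A : set R) : measurable A -> m A = mu (A `&` I01).
Proof.
move=> mA; rewrite -[A in LHS]setIT -integral_indic// integral_uniform//.
- by rewrite subr0 invr1 mul1e integral_indic.
- by apply/measurable_EFinP; exact: measurable_indic.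
Qed.

Lemma ae_uniform01 (Q : R -> Prop) :
  {ae m, forall x, Q x} <-> {ae mu, forall x, I01 x -> Q x}.
Proof.
split=> -[N [mN N0 QN]].
  exists (N `&` I01); split; [exact: measurableI| |].
    by rewrite -uniform_prob01E.
  move=> x /= /not_implyP[xI nQ]; split => //; exact: QN.
(* The complement of the unit interval is null for the uniform law, so it can join the exceptional
   set. *)
exists (N `|` ~` I01); split; [by apply: measurableU => //;
  exact: measurableC| |].
  rewrite uniform_prob01E; last by apply: measurableU => //; exact: measurableC.
  rewrite setIUl setICl setU0; apply/eqP; rewrite -measure_le0 -N0.
  by rewrite le_measure ?inE//; exact: measurableI.
move=> x /= nQ; have [xI|xI] := pselect (I01 x); last by right.
by left; apply: QN => /(_ xI).
Qed.

End UniformProbability.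

(** Extending [W] by 0 makes symmetry, bounds and measurability global, whereas a graphon satisfies
    them only on the unit square. *)
Definition unit_kernel {R : realType} (W : R -> R -> R) (x y : R) : R :=
  ((fun p : R * R => W p.1 p.2) \_ (`[0, 1] `*` `[0, 1])%classic) (x, y).

Section UnitKernel.
Context {R : realType} (W : R -> R -> R).
Local Notation I01 := (`[0%R, 1%R]%classic : set R).

Lemma unit_kernelE x y : I01 x -> I01 y -> unit_kernel W x y = W x y.
Proof. by move=> xI yI; rewrite /unit_kernel patchE mem_set. Qed.

Hypothesis W_graphon : graphon W.

Lemma unit_kernel01 x y : 0 <= unit_kernel W x y <= 1.
Proof.
rewrite /unit_kernel patchE; case: ifPn => [/set_mem[/= xI yI]|_].
  by have [_ _] := W_graphon; apply; exact: mem_set.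
by rewrite lexx ler01.
Qed.

Lemma unit_kernel_sym x y : unit_kernel W x y = unit_kernel W y x.
Proof.
rewrite /unit_kernel !patchE; case: ifPn => [/set_mem[/= xI yI]|nxy].
  have [_ Wsym _] := W_graphon.
  by rewrite mem_set//=; apply: Wsym; exact: mem_set.
rewrite memNset// => -[/= yI xI]; move/negP: nxy; apply.
by rewrite inE.
Qed.

Lemma bounded_measurable2_unit_kernel : bounded_measurable2 (unit_kernel W).
Proof.
split.
  have [mW _ _] := W_graphon.
  rewrite [X in measurable_fun _ X](_ : _ =
    (fun p : R * R => W p.1 p.2) \_ (I01 `*` I01)); last by apply/funext => -[].
  by apply/(measurable_restrictT _ _).1 => //; exact: measurableX.
exists 1 => p; have := unit_kernel01 p.1 p.2 => /andP[w0 w1].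
by rewrite ger0_norm.
Qed.

End UnitKernel.

(* A measurability notion for functions of the (possibly infinite) assignments
   [V -> R] that involves no sigma-algebra on the latter. *)
Definition bounded_measurable_functional {R : realType} {V : eqType}
    (f : (V -> R) -> R) : Prop :=
  forall (d : measure_display) (T : measurableType d) (phi : T -> V -> R),
    (forall v, measurable_fun setT (phi ^~ v)) ->
    bounded_measurable (fun t => f (phi t)).

Section IteratedIntegral.
Context {R : realType} {V : eqType}.
Local Notation mu := (@lebesgue_measure R).
Local Notation m := (uniform_prob (@ltr01 R)).
Local Notation I01 := (`[0%R, 1%R]%classic : set R).
Implicit Types (f g : (V -> R) -> R) (s : seq V) (x : V -> R).

Fixpoint iterated_integral s f x : R :=
  if s is v :: s' then
    \int[m]_y iterated_integral s' f [eta x with v |-> y]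
  else f x.

Lemma bounded_measurable_functional_integral f v :
  bounded_measurable_functional f ->
  bounded_measurable_functional
    (fun x => \int[m]_y f [eta x with v |-> y]).
Proof.
move=> bf d T phi mphi.
apply: (bounded_measurable_integralT m
  (K := fun t y => f [eta phi t with v |-> y])).
apply: (bf _ _ (fun p : T * R => [eta phi p.1 with v |-> p.2])) => u /=.
case: eqP => _; first exact: measurable_snd.
exact: (measurableT_comp (mphi u) measurable_fst).
Qed.

Lemma bounded_measurable_functional_iterated s f :
  bounded_measurable_functional f ->
  bounded_measurable_functional (iterated_integral s f).
Proof.
move=> bf; elim: s => //= v s IHs.
exact: (bounded_measurable_functional_integral v IHs).
Qed.

Lemma bounded_measurable_functional_slice f v x :
  bounded_measurable_functional f ->
  bounded_measurable (fun y => f [eta x with v |-> y]).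
Proof.
move=> bf; apply: (bf _ _ (fun y => [eta x with v |-> y])) => u /=.
by case: eqP.
Qed.

Lemma le_iterated_integral s f g x :
  bounded_measurable_functional f -> bounded_measurable_functional g ->
  (forall y, f y <= g y) -> iterated_integral s f x <= iterated_integral s g x.
Proof.
move=> bf bg fg; elim: s x => //= v s IHs x.
apply: le_integralT => //; apply: bounded_measurable_functional_slice;
  exact: bounded_measurable_functional_iterated.
Qed.

Lemma integrate_outE s f x : bounded_measurable_functional f ->
  integrate_out s f x = iterated_integral s f x.
Proof.
move=> bf; elim: s x => //= v s IHs x.
under eq_Rintegral do rewrite IHs.
apply: Rintegral_uniform01; apply: bounded_measurable_functional_slice.
exact: bounded_measurable_functional_iterated.
Qed.

(** Starting from an assignment in the unit interval, the iterated integrals only evaluate the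
    integrand at such assignments; this allows [W] to be replaced by [unit_kernel W]. *)
Lemma eq_integrate_out s f g x : (forall v, I01 (x v)) ->
  (forall y, (forall v, I01 (y v)) -> f y = g y) ->
  integrate_out s f x = integrate_out s g x.
Proof.
move=> xI fg; elim: s x xI => [x|v s IHs x xI] /=; first exact: fg.
apply: eq_Rintegral => y yI; apply: IHs => u /=.
by case: eqP => _; [exact: set_mem|exact: xI].
Qed.

Variable W : R -> R -> R.
Hypothesis W_graphon : graphon W.
Local Notation w := (unit_kernel W).

Lemma bounded_measurable_functional_edge_prod (F : multigraph V) :
  bounded_measurable_functional (edge_prod w F).
Proof.
move=> d T phi mphi; rewrite /edge_prod;
  have bw := bounded_measurable2_unit_kernel W_graphon.
elim: (medges F) => [|e s IHs].
  by under eq_fun do rewrite big_nil; exact: bounded_measurable_cst.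
under eq_fun do rewrite big_cons.
apply: bounded_measurableM => //.
exact: (bounded_measurable2_comp bw).
Qed.

Lemma integrate_out_edge_prod (F : multigraph V) s x : (forall v, I01 (x v)) ->
  integrate_out s (edge_prod W F) x = iterated_integral s (edge_prod w F) x.
Proof.
move=> xI; rewrite -integrate_outE; last first.
  exact: bounded_measurable_functional_edge_prod.
apply: eq_integrate_out => // y yI; apply: eq_bigr => e _.
by rewrite unit_kernelE.
Qed.

Lemma densityE (F : multigraph V) :
  density F W = iterated_integral (mvertices F) (edge_prod w F) (fun=> 0).
Proof.
by apply: integrate_out_edge_prod => v; rewrite /= in_itv/= lexx ler01.
Qed.

Lemma marked_densityE (marks : seq V) (xs : seq R) (F : multigraph V) :
  (forall r : R, r \in xs -> I01 r) ->
  marked_density marks xs F W =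
  iterated_integral [seq v <- mvertices F | v \notin marks] (edge_prod w F)
    (fun v => nth 0 xs (index v marks)).
Proof.
move=> xsI; apply: integrate_out_edge_prod => v.
have [h|h] := ltnP (index v marks) (size xs); first by apply: xsI;
  exact: mem_nth.
(* Unmarked vertices receive the default value 0, which lies in the unit interval. *)
by rewrite nth_default//= in_itv/= lexx ler01.
Qed.

End IteratedIntegral.

(** * Densities and kernel of the 2-star *)

(** [v0] is the centre of the star, [v1] and [v2] are its leaves. *)
Local Notation v0 := (@ord0 2).
Local Notation v1 := (@Ordinal 3 1 isT).
Local Notation v2 := (@Ordinal 3 2 isT).

Lemma enum_I3 : enum 'I_3 = [:: v0; v1; v2].
Proof. by apply: (inj_map val_inj); rewrite val_enum_ord. Qed.

Lemma edges_K12 : edges K12 = [:: (v0, v1); (v0, v2)].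
Proof.
by rewrite /edges enumT unlock /= /prod_enum enum_I3.
Qed.

Lemma sum_I3 (R : realType) (F : 'I_3 -> R) :
  \sum_(i < 3) F i = F v0 + F v1 + F v2.
Proof.
rewrite !big_ord_recl big_ord0 addr0 addrA.
by congr (F _ + F _ + F _); exact: val_inj.
Qed.

Lemma card_automorphisms_gt0 k (H : sgraph k) : (0 < #|automorphisms H|)%N.
Proof.
apply/card_gt0P; exists 1%g; rewrite inE.
by apply/forallP => a; apply/forallP => b; rewrite !perm1.
Qed.

Section StarDensities.
Context {R : realType} (W : R -> R -> R).
Hypothesis W_graphon : graphon W.
Local Notation m := (uniform_prob (@ltr01 R)).
Local Notation I01 := (`[0%R, 1%R]%classic : set R).
Local Notation w := (unit_kernel W).
Local Notation deg := (degree m w).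
Local Notation codeg := (codegree m w).

Let bw := bounded_measurable2_unit_kernel W_graphon.
Let bdeg := bounded_measurable_degree m bw.
Let wC := unit_kernel_sym W_graphon.

Lemma edge_prod_K12 x :
  edge_prod w (multigraph_of K12) x = w (x v0) (x v1) * w (x v0) (x v2).
Proof. by rewrite /edge_prod /= edges_K12 !big_cons big_nil mulr1. Qed.

Lemma star_marked0 x : I01 x ->
  marked_density [:: v0] [:: x] (multigraph_of K12) W = deg x ^+ 2.
Proof.
move=> xI; rewrite marked_densityE//; last first.
  by move=> r; rewrite inE => /eqP ->.
rewrite /= enum_I3/=.
rewrite expr2 -integralTZl; last by bounded_meas.
apply: eq_integralT => y; rewrite mulrC -integralTZl; last by bounded_meas.
by apply: eq_integralT => z; rewrite edge_prod_K12.
Qed.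

Lemma star_marked1 x : I01 x ->
  marked_density [:: v1] [:: x] (multigraph_of K12) W =
    \int[m]_y (w x y * deg y).
Proof.
move=> xI; rewrite marked_densityE//; last first.
  by move=> r; rewrite inE => /eqP ->.
rewrite /= enum_I3/=; apply: eq_integralT => y.
rewrite -integralTZl; last by bounded_meas.
by apply: eq_integralT => z; rewrite edge_prod_K12/= wC.
Qed.

Lemma star_marked2 x : I01 x ->
  marked_density [:: v2] [:: x] (multigraph_of K12) W =
    \int[m]_y (w x y * deg y).
Proof.
move=> xI; rewrite marked_densityE//; last first.
  by move=> r; rewrite inE => /eqP ->.
rewrite /= enum_I3/=; apply: eq_integralT => y.
rewrite -integralTZl; last by bounded_meas.
by apply: eq_integralT => z; rewrite edge_prod_K12/= mulrC wC.
Qed.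

Lemma star_marked_edge x y (a b : 'I_3) : I01 x -> I01 y ->
  marked_density [:: a; b] [:: x; y] (multigraph_of K12) W =
  iterated_integral [seq v <- enum 'I_3 | v \notin [:: a; b]]
    (edge_prod w (multigraph_of K12))
    (fun v => nth 0 [:: x; y] (index v [:: a; b])).
Proof.
move=> xI yI; rewrite marked_densityE// => r.
by rewrite !inE => /orP[]/eqP ->.
Qed.

(** Four of the six ordered pairs join the centre to a leaf and give [w x y] times the degree of the
    centre; the two pairs of leaves give the codegree. Each term occurs twice, which cancels the 2
    in the normalisation. *)
Lemma star_W_H x y : I01 x -> I01 y ->
  W_H K12 W x y = (#|automorphisms K12|%:R)^-1 *
    (w x y * (deg x + deg y) + codeg x y).
Proof.
move=> xI yI; rewrite /W_H.
have bwx (z : R) : bounded_measurable (w z) by bounded_meas.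
have E01 : marked_density [:: v0; v1] [:: x;
  y] (multigraph_of K12) W = w x y * deg x.
  rewrite star_marked_edge// enum_I3/= -integralTZl; last exact: bwx.
  by apply: eq_integralT => z; rewrite edge_prod_K12.
have E02 : marked_density [:: v0; v2] [:: x;
  y] (multigraph_of K12) W = w x y * deg x.
  rewrite star_marked_edge// enum_I3/= -integralTZl; last exact: bwx.
  by apply: eq_integralT => z; rewrite edge_prod_K12/= mulrC.
have E10 : marked_density [:: v1; v0] [:: x;
  y] (multigraph_of K12) W = w x y * deg y.
  rewrite star_marked_edge// enum_I3/= -integralTZl; last exact: bwx.
  by apply: eq_integralT => z; rewrite edge_prod_K12/= (wC y x).
have E20 : marked_density [:: v2; v0] [:: x;
  y] (multigraph_of K12) W = w x y * deg y.
  rewrite star_marked_edge// enum_I3/= -integralTZl; last exact: bwx.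
  by apply: eq_integralT => z; rewrite edge_prod_K12/= (wC y x) mulrC.
have E12 : marked_density [:: v1; v2] [:: x;
  y] (multigraph_of K12) W = codeg x y.
  rewrite star_marked_edge// enum_I3/=.
  by apply: eq_integralT => z; rewrite edge_prod_K12/= (wC z x) (wC z y).
have E21 : marked_density [:: v2; v1] [:: x;
  y] (multigraph_of K12) W = codeg x y.
  rewrite star_marked_edge// enum_I3/=.
  by apply: eq_integralT => z; rewrite edge_prod_K12/= (wC z x) (wC z y) mulrC.
rewrite sum_I3 (big_mkcond (fun b => b != v0)) (big_mkcond (fun b => b != v1)).
rewrite (big_mkcond (fun b => b != v2)) !sum_I3/= E01 E02 E10 E20 E12 E21.
by rewrite invfM; field; rewrite pnatr_eq0 -lt0n card_automorphisms_gt0.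
Qed.

(** With [codegree_integral], this says that the constant 1 is an eigenfunction of the unnormalised
    kernel, for the eigenvalue [3 * t K12 W]. *)
Lemma star_degree_equation : regular K12 W ->
  {ae m, forall x, deg x ^+ 2 + 2 * \int[m]_y (w x y * deg y) = 3 * t K12 W}.
Proof.
move=> [N [mN N0 sN]]; apply/ae_uniform01; exists N; split => // x /= nQ.
apply: sN => /= Q; apply: nQ => xI; rewrite -(Q xI).
rewrite sum_I3 star_marked0// star_marked1// star_marked2//.
by field.
Qed.

Lemma codegree_integral x : \int[m]_y codeg x y = \int[m]_y (w x y * deg y).
Proof.
rewrite integralT_swap; last by rewrite /bounded_measurable2; bounded_meas.
apply: eq_integralT => z; rewrite integralTZl; last by bounded_meas.
by congr (_ * _); apply: eq_integralT => y; rewrite wC.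
Qed.

Lemma le_density_oplus_ominus k (H : sgraph k) (a b c d : 'I_k) :
  density (oplus H a b c d) W <= density (ominus H a b c d) W.
Proof.
rewrite !densityE//; apply: le_iterated_integral;
  [exact: bounded_measurable_functional_edge_prod..|].
have w01 u v : 0 <= w u v <= 1 by exact: unit_kernel01.
have w_ge0 u v : 0 <= w u v by have /andP[] := w01 u v.
move=> y; rewrite /edge_prod !big_cat/= !big_map big_filter.
apply: ler_wpM2l.
  by apply: prodr_ge0 => e _; exact: w_ge0.
(* The edges of the second copy split into those kept by [ominus] and the doubled one, which
   contributes a factor at most 1. *)
rewrite (bigID (fun e => (e != (c, d)) && (e != (d, c))))/=.
apply: ler_piMr.
  by apply: prodr_ge0 => e _; exact: w_ge0.
by apply: prodr_ile1 => e _; exact: w01.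
Qed.

(** The glued stars share the centre [x] and the leaf [y]; each of the two remaining leaves
    integrates to [deg x]. *)
Lemma star_density_ominus :
  density (ominus K12 v0 v1 v0 v1) W = \int[m]_x \int[m]_y (w x y * deg x ^+ 2).
Proof.
rewrite densityE//= /glue_vertices enum_I3/=.
apply: eq_integralT => x; apply: eq_integralT => y.
rewrite expr2 mulrA -integralTZl; last by bounded_meas.
apply: eq_integralT => z; rewrite -mulrA (mulrC (deg x)) mulrA -integralTZl;
  last by bounded_meas.
apply: eq_integralT => z'.
by rewrite /edge_prod /= edges_K12/= !big_cons big_nil/= mulr1 mulrA.
Qed.

Lemma star_density_oplus :
  density (oplus K12 v0 v1 v0 v1) W =
  \int[m]_x \int[m]_y (w x y ^+ 2 * deg x ^+ 2).
Proof.
rewrite densityE//= /glue_vertices enum_I3/=.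
apply: eq_integralT => x; apply: eq_integralT => y.
rewrite [deg x ^+ 2]expr2 mulrA -integralTZl; last by bounded_meas.
apply: eq_integralT => z; rewrite -mulrA (mulrC (deg x)) mulrA -integralTZl;
  last by bounded_meas.
apply: eq_integralT => z'.
rewrite /edge_prod /= edges_K12/= !big_cons big_nil/=.
by ring.
Qed.

Lemma star_sigma0_ae : sigma K12 W = 0 ->
  {ae m, forall x, {ae m, forall y, w x y * (1 - w x y) * deg x ^+ 2 = 0}}.
Proof.
move=> sigma0; have w01 x y : 0 <= w x y <= 1 by exact: unit_kernel01.
apply: integral2_eq0_ae; first by rewrite /bounded_measurable2; bounded_meas.
  move=> x y; have /andP[w0 w1] := w01 x y.
  by rewrite mulr_ge0 ?sqr_ge0// mulr_ge0// subr_ge0.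
have -> : \int[m]_x \int[m]_y (w x y * (1 - w x y) * deg x ^+ 2) =
    density (ominus K12 v0 v1 v0 v1) W - density (oplus K12 v0 v1 v0 v1) W.
  rewrite star_density_ominus star_density_oplus -integralTB;
    [|by bounded_meas..].
  apply: eq_integralT => x; rewrite -integralTB; [|by bounded_meas..].
  by apply: eq_integralT => y; ring.
pose D (p q : 'I_3 * 'I_3) := density (ominus K12 p.1 p.2 q.1 q.2) W
  - density (oplus K12 p.1 p.2 q.1 q.2) W.
have D0 p q : 0 <= D p q by rewrite subr_ge0; exact: le_density_oplus_ominus.
have : \sum_(p : 'I_3 * 'I_3 | K12 p.1 p.2)
    \sum_(q : 'I_3 * 'I_3 | K12 q.1 q.2) D p q <= 0.
  (* The square root is 0 on all non-positive arguments, so this yields only an upper bound; the sum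
     vanishes because its terms are non-negative. *)
  move/eqP: sigma0; rewrite sqrtr_eq0 /sigma2 pmulr_rle0// invr_gt0.
  by rewrite mulr_gt0// exprn_gt0// ltr0n card_automorphisms_gt0.
rewrite le_eqVlt ltNge sumr_ge0 ?orbF; last by move=> p _; exact: sumr_ge0.
rewrite psumr_eq0; last by move=> p _; exact: sumr_ge0.
move=> /allP/(_ (v0, v1) (mem_index_enum _))/implyP/(_ isT).
rewrite psumr_eq0; last by move=> q _.
by move=> /allP/(_ (v0, v1) (mem_index_enum _))/implyP/(_ isT)/eqP.
Qed.

End StarDensities.

(** * Non-degeneracy *)

Section Conclusion.
Context {R : realType} (W : R -> R -> R).
Hypothesis W_graphon : graphon W.
Local Notation mu := (@lebesgue_measure R).
Local Notation m := (uniform_prob (@ltr01 R)).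
Local Notation I01 := (`[0%R, 1%R]%classic : set R).
Local Notation w := (unit_kernel W).
Local Notation deg := (degree m w).
Local Notation codeg := (codegree m w).

Let bw := bounded_measurable2_unit_kernel W_graphon.
Let bdeg := bounded_measurable_degree m bw.
Let bcodeg := bounded_measurable2_codegree m bw.
Let wC := unit_kernel_sym W_graphon.

Lemma ae_lebesgue_product (Q : R * R -> Prop) :
  measurable [set p | Q p] ->
  {ae m, forall x, {ae m, forall y, Q (x, y)}} ->
  {ae (mu \x mu)%E, forall p : R * R, (I01 `*` I01) p -> Q p}.
Proof.
move=> mQ aeQ; pose S := (I01 `*` I01) `\` [set p | Q p].
have mS : measurable S by apply: measurableD => //; exact: measurableX.
exists S; split => //; last first.
  by move=> p /= /not_implyP[pI nQ]; split.
have : {ae mu, forall x, I01 x -> mu (xsection S x) = 0%E}.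
  apply/ae_uniform01; apply: ae_mono aeQ => x Qx.
  have mQx : measurable [set y | Q (x, y)].
    have := measurable_xsection x mQ; rewrite xsectionE.
    by congr measurable; apply/seteqP; split.
  apply/eqP; rewrite -measure_le0.
  have <- : m (~` [set y | Q (x, y)]) = 0%E.
    by move/negligibleP : Qx; apply; exact: measurableC.
  rewrite uniform_prob01E; last exact: measurableC.
  apply: le_measure; rewrite ?inE.
  - exact: measurable_xsection.
  - by apply: measurableI => //; exact: measurableC.
  - by move=> y; rewrite xsectionE => -[[/= _ yI] nQ].
move=> [N [mN N0 sN]].
(* The product measure is the integral of the measures of the sections, which are almost all 0. *)
rewrite -[LHS]/(\int[mu]_x (mu \o xsection S) x)%E.
have -> : 0%E = (\int[mu]_x (cst 0 x))%E by rewrite integral0.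
apply: ae_eq_integral => //; first exact: measurable_fun_xsection.
exists N; split => // x /= nx; apply: sN => /= Sx0; apply: nx => _.
have [xI|xI] := pselect (I01 x); first by rewrite Sx0.
rewrite (_ : xsection S x = set0) ?measure0//.
by apply/seteqP; split => // y; rewrite xsectionE => -[[]].
Qed.

Lemma ae_eq1_graphon :
  {ae m, forall x, {ae m, forall y, w x y = 1}} ->
  {ae (mu \x mu)%E, forall p : R * R, (I01 `*` I01) p -> W p.1 p.2 = 1}.
Proof.
move=> w1; have [mw _] := bw.
have := @ae_lebesgue_product (fun p => w p.1 p.2 = 1) _ w1.
have m1 : measurable [set p | w p.1 p.2 = 1].
  rewrite [X in measurable X](_ : _ = (fun p => w p.1 p.2) @^-1` [set 1])//.
  by rewrite -[_ @^-1` _]setTI; apply: mw => //; exact: measurable_set1.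
move=> /(_ m1) [N [mN N0 sN]]; exists N; split => // p /= np;
  apply: sN => /= wp.
by apply: np => -[p1 p2]; rewrite -wp// unit_kernelE.
Qed.

Lemma eigenfunction_W_H (r : R) (f : R -> R) : bounded_measurable f ->
  {ae m, forall x, \int[m]_y ((w x y * (deg x + deg y) + codeg x y) * f y) =
    r * f x} ->
  eigenfunction (W_H K12 W) ((#|automorphisms K12|%:R)^-1 * r) f.
Proof.
move=> bf Kf; have [mf _] := bf; split.
  split; first exact: measurable_funTS.
  apply: (bounded_measurable_integrable01 (g := fun x => f x ^+ 2)).
  by bounded_meas.
apply: (ae_mono _ ((ae_uniform01 _).1 Kf)) => x /[swap] xI /(_ xI) {}Kf.
rewrite -mulrA -Kf -integralTZl; last by bounded_meas.
rewrite -Rintegral_uniform01; last by bounded_meas.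
apply: eq_Rintegral => y /set_mem yI.
by rewrite star_W_H// mulrA.
Qed.

(** No index has value [r], so the truncated difference that counts them is 0; this leaves at most
    one dimension, and only for [d_WH]. *)
Lemma multiplicity_spec_minus_eq0 (lam : nat -> R) (r : R) :
  enumerates_spec_minus K12 W lam -> (forall i, lam i = 0) -> r != 0 ->
  exists2 k, multiplicity (W_H K12 W) r k & (k <= (r == d_WH K12 W))%N.
Proof.
move=> lam_spec lam0 r0; have [k mult_k card_k] := lam_spec r r0.
exists k => //; move: card_k; set j := (k - _)%N.
rewrite (_ : [set i | lam i = r] = set0) => [card_j|]; last first.
  by apply/seteqP; split => // i /=; rewrite lam0 => /esym/eqP;
    rewrite (negbTE r0).
suff /eqP : j = 0%N by rewrite subn_eq0.
by apply/card_eq_II; rewrite card_eq_sym II0.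
Qed.

(** Only the eigenspace of [d_WH] can be non-trivial, and it is then the line of the constants, to
    which [f] is orthogonal. *)
Lemma spec_minus_empty_orthogonal (lam : nat -> R) (r : R) (f : R -> R) :
  enumerates_spec_minus K12 W lam -> (forall i, lam i = 0) ->
  eigenfunction (W_H K12 W) (d_WH K12 W) (fun=> 1) ->
  r != 0 -> bounded_measurable f -> eigenfunction (W_H K12 W) r f ->
  \int[m]_x f x = 0 -> \int[m]_x (f x ^+ 2) = 0.
Proof.
move=> lam_spec lam0 eig1 r0 bf eigf f_orth.
have ae0 : {ae m, forall x, f x = 0} -> \int[m]_x (f x ^+ 2) = 0.
  move=> f0; rewrite -[RHS](integralT_cst m); apply: ae_eq_integralT.
  - by bounded_meas.
  - by bounded_meas.
  - by apply: ae_mono f0 => x ->; rewrite expr0n.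
have [k [e [_ _ gen_e]] kr] := multiplicity_spec_minus_eq0 lam_spec lam0 r0.
case: k e gen_e kr => [|[|k]] e gen_e; last by case: (_ == _).
  move=> _; have [c fc] := gen_e f eigf; apply: ae0.
  by apply: ae_mono ((ae_uniform01 _).2 fc) => x ->; rewrite big_ord0.
case: eqP => // rd _.
have [c1 f_c1] := gen_e f eigf.
rewrite rd in gen_e; have [c0 one_c0] := gen_e _ eig1.
(* Both [f] and 1 are multiples of the single basis function, with coefficients [c1] and [c0];
   eliminating it makes [c0 * f] constant. *)
have fE : {ae m, forall x, c0 ord0 * f x = c1 ord0}.
  apply: ae_mono2 ((ae_uniform01 _).2 f_c1) ((ae_uniform01 _).2 one_c0) => x.
  by rewrite !big_ord1 => -> one; rewrite mulrCA -one mulr1.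
have c1_0 : c1 ord0 = 0.
  have : \int[m]_x (c0 ord0 * f x) = c1 ord0.
    rewrite -[RHS](integralT_cst m); apply: ae_eq_integralT => //;
      by bounded_meas.
  by rewrite integralTZl// f_orth mulr0.
apply: ae0; apply: ae_mono ((ae_uniform01 _).2 f_c1) => x ->.
by rewrite big_ord1 c1_0 mul0r.
Qed.

Lemma star_spec_minus_empty (lam : nat -> R) :
  regular K12 W -> 0 < t K12 W ->
  enumerates_spec_minus K12 W lam -> (forall i, lam i = 0) ->
  sigma K12 W = 0 ->
  {ae (mu \x mu)%E, forall p : R * R, (I01 `*` I01) p -> W p.1 p.2 = 1}.
Proof.
move=> reg t_gt0 lam_spec lam0 sigma0; apply: ae_eq1_graphon.
(* Subtracting [3 * t K12 W] removes the eigenvalue of the constants, so that every eigenfunction of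
   [K] for a non-zero eigenvalue is orthogonal to them. *)
pose K x y := w x y * (deg x + deg y) + codeg x y - 3 * t K12 W.
have bK : bounded_measurable2 K by rewrite /bounded_measurable2 /K;
  bounded_meas.
have symK x y : K x y = K y x.
  rewrite /K wC (addrC (deg x)); congr (_ + _ - _).
  by apply: eq_integralT => z; rewrite mulrC.
have K1 : {ae m, forall x, \int[m]_y K x y = 0}.
  apply: ae_mono (star_degree_equation W_graphon reg) => x degx.
  rewrite /K integralTB; [|by bounded_meas..].
  rewrite integralT_cst integralTD; [|by bounded_meas..].
  rewrite codegree_integral//.
  under eq_integralT do rewrite mulrDr.
  rewrite integralTD; [|by bounded_meas..].
  rewrite integralTZr -/(deg x); last by bounded_meas.
  by rewrite -degx; ring.
(* The correction term undoes the subtraction. It serves for [f = 1], where it cancels [r * f], and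
   for [f] orthogonal to 1, where it is 0. *)
have eigK r f : bounded_measurable f ->
    {ae m, forall x, kernel_app m K f x =
      r * f x - 3 * t K12 W * \int[m]_y f y} ->
    eigenfunction (W_H K12 W) (#|automorphisms K12|%:R^-1 * r) f.
  move=> bf Kf; apply: eigenfunction_W_H => //; apply: ae_mono Kf => x Kf.
  rewrite -[RHS](subrK (3 * t K12 W * \int[m]_y f y)) -Kf -integralTZl//.
  rewrite -integralTD; [|by bounded_meas..].
  by apply: eq_integralT => y; rewrite /K; ring.
have N_gt0 : 0 < #|automorphisms K12|%:R^-1 :> R.
  by rewrite invr_gt0 ltr0n card_automorphisms_gt0.
have dE : d_WH K12 W = #|automorphisms K12|%:R^-1 * (3 * t K12 W).
  by rewrite /d_WH invfM/=; field;
    rewrite pnatr_eq0 -lt0n card_automorphisms_gt0.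
have eig1 : eigenfunction (W_H K12 W) (d_WH K12 W) (fun=> 1).
  rewrite dE; apply: eigK; first exact: bounded_measurable_cst.
  apply: ae_mono K1 => x K1x; rewrite integralT_cst mulr1 subrr -[RHS]K1x.
  by apply: eq_integralT => y; rewrite mulr1.
have [K0|K_neq0] := eqVneq (kernel_norm2 m K) 0; last first.
  have [r [f [r0 bf f_neq0 f_orth Kf]]] :=
    symmetric_kernel_eigenfunction_orthogonal (m := m) bK symK K_neq0 K1.
  exfalso; move/eqP: f_neq0; apply.
  apply: (spec_minus_empty_orthogonal (r := #|automorphisms K12|%:R^-1 * r)
    lam_spec lam0 eig1 _ bf _ f_orth); first by rewrite mulf_neq0// gt_eqF.
  by apply: eigK => //; rewrite f_orth mulr0; apply: ae_mono Kf => x;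
    rewrite subr0.
apply: (star_kernel_constant (m := m) (c := 3 * t K12 W) bw wC
  (unit_kernel01 W_graphon)).
- by rewrite mulr_gt0.
- exact: star_sigma0_ae.
have bK2 : bounded_measurable2 (fun x y => K x y ^+ 2).
  by rewrite /bounded_measurable2; bounded_meas.
have := integral2_eq0_ae (m := m) bK2 (fun x y => sqr_ge0 (K x y)) K0.
apply: ae_mono => x; apply: ae_mono => y /eqP.
by rewrite sqrf_eq0 subr_eq0 => /eqP.
Qed.

End Conclusion.

Unset Implicit Arguments.
Set Strict Implicit.

Theorem theorem4p10 (R : realType) (W : R -> R -> R)
  (W_graphon : graphon W)
  (W_regular : regular K12 W)
  (t_gt0 : 0 < t K12 W)
  (W_neq1 : ~ {ae (@lebesgue_measure R \x @lebesgue_measure R)%E,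
                 forall p : R * R, (`[0, 1] `*` `[0, 1])%classic p ->
                   W p.1 p.2 = 1})
  (lam : nat -> R) (lam_spec : enumerates_spec_minus K12 W lam)
  (d' : measure_display) (T' : measurableType d') (P' : probability T' R)
  (Z : {RV P' >-> R}) (G : nat -> {RV P' >-> R})
  (ZG_gaussian : gaussian_sample Z G)
  (L : {RV P' >-> R}) (L_limit : limit_variable K12 W lam Z G L) :
  nondegenerate_law (distribution P' L) /\
  forall (d : measure_display) (T : measurableType d) (P : probability T R)
    (U : nat -> {RV P >-> R}) (Y : nat -> nat -> {RV P >-> R}),
    uniform_sample U Y ->
    cvg_in_law P (Z_n K12 W U Y) (distribution P' L) ->
    forall nu : probability R R,
      cvg_in_law P (Z_n K12 W U Y) nu -> nondegenerate_law nu.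
Proof.
have L_nondeg : nondegenerate_law (distribution P' L).
  move=> [c Lc].
  have aeL : {ae P', forall x, L x = c}.
    have mc : measurable (L @^-1` [set c]).
      by rewrite -[_ @^-1` _]setTI; apply: measurable_funP => //;
        exact: measurable_set1.
    exists (~` (L @^-1` [set c])); split => //; first exact: measurableC.
    exact: probability_setC_eq0.
  have [sigma0 lam0] : sigma K12 W = 0 /\ forall i, lam i = 0.
    apply: (gaussian_limit_degenerate (c := c) ZG_gaussian).
    by apply: ae_mono2 L_limit aeL => x + <-.
  exact/W_neq1/(star_spec_minus_empty W_graphon W_regular t_gt0 lam_spec lam0).
split=> // d T P U Y _ ZL nu Znu [c nuc].
(* A point mass as limit law would force the law of [L] to be the same point mass. *)
by apply: L_nondeg; exists c; exact: cvg_in_law_dirac ZL Znu nuc.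
Qed.
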